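(* Let $\ell,D\ge 1$ and let $F_1,\ldots,F_{\ell+1}\in\mathbb{C}[X_1,\ldots,X_{\ell}]$ be multiplicatively independent polynomials of degree at most $D$. Put $\gamma_{\ell}(D)=\binom{\ell+1+D^\ell}{\ell+1}$. Then the set $$\bigcup_{n_1,\ldots,n_{\ell+1}\ge 1}Z\big(F_1^{n_1}-1,\ldots,F_{\ell+1}^{n_{\ell+1}}-1\big)$$ (union over positive integers $n_1,\ldots,n_{\ell+1}$) is contained in the union of at most $$N\le \big(0.792\,\gamma_{\ell}(D)/\log(\gamma_{\ell}(D)+1)\big)^{\gamma_{\ell}(D)}$$ algebraic varieties, each defined by at most $\ell+1$ polynomials of degree at most $(\ell+1)D^{\ell+1}\prod_{p\le \gamma_{\ell}(D)}p$, where the product runs over all primes $p\le\gamma_{\ell}(D)$.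
   Context: $Z(P_1,\ldots,P_s)$ denotes the common zero set in $\mathbb{C}^\ell$ of $P_1,\ldots,P_s$. Polynomials $F_1,\ldots,F_{s}$ are multiplicatively independent if there is no nonzero vector $(\nu_1,\ldots,\nu_s)\in\mathbb{Z}^s$ with $F_1^{\nu_1}\cdots F_s^{\nu_s}=1$. $\log$ is the natural logarithm. *)

(* Defs.v *)
From HB Require Import structures.
From mathcomp Require Import all_boot all_order all_algebra.
From mathcomp Require Import complex mpoly.
From mathcomp Require Import classical_sets reals.
From mathcomp Require exp.

Set Implicit Arguments.
Unset Strict Implicit.
Unset Printing Implicit Defensive.

Import GRing.Theory.

Local Open Scope ring_scope.
Local Open Scope classical_set_scope.

(* [msize p] is the total degree plus one for p != 0; constants, including 0,
   get degree 0 here. *)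
Definition tdegree (K : nzRingType) (l : nat) (p : {mpoly K[l]}) : nat :=
  (msize p).-1.

Definition zero_set (K : comNzRingType) (l s : nat) (P : 'I_s -> {mpoly K[l]}) :
    set ('I_l -> K) :=
  [set x | forall i, (P i).@[x] = 0].

(* The exponents may be negative, so the product is taken in the field of
   fractions of K[X_1, ..., X_l]. *)
Definition mult_independent (K : idomainType) (l s : nat)
    (F : 'I_s -> {mpoly K[l]}) : Prop :=
  ~ exists nu : 'I_s -> int,
      (exists i, nu i != 0) /\
      \prod_(i < s) (tofrac (F i) : {fraction {mpoly K[l]}}) ^ (nu i) = 1.

(* A variety is presented by a nonempty family of nonzero polynomials: with the
   zero polynomial or the empty family allowed, the whole affine space would
   qualify and covering a set by such varieties would be no constraint. *)
Definition variety_defined_by_at_most (K : idomainType) (l m d : nat)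
    (V : set ('I_l -> K)) : Prop :=
  exists (s : nat) (P : 'I_s -> {mpoly K[l]}),
    [/\ (0 < s <= m)%N,
        forall k, P k != 0,
        forall k, (tdegree (P k) <= d)%N
      & V = zero_set P].

Definition gamma (l D : nat) : nat := 'C(l + 1 + D ^ l, l + 1).

Definition primorial (n : nat) : nat := (\prod_(0 <= p < n.+1 | prime p) p)%N.

(* Main.v *)
Require Import Defs.
From mathcomp Require Import all_boot all_order all_algebra.
From mathcomp Require Import complex mpoly.
From mathcomp Require Import classical_sets reals.
From mathcomp Require exp boolp.
From mathcomp Require Import perm separable algC cyclotomic.
From mathcomp Require Import ring lra zify.

Set Implicit Arguments.
Unset Strict Implicit.
Unset Printing Implicit Defensive.

Import Order.TTheory GRing.Theory Num.Theory.

(** Perron's theorem provides a relation P(F_1, ..., F_(l+1)) = 0 of degree at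
    most D^l, hence with at most gamma monomials; P is taken with minimal
    support, so that a linear combination of the monomials F^a, a in the support
    of P, vanishes identically only if it is proportional to P.  If all the
    F_i(x) are roots of unity, P becomes at x a vanishing sum of roots of unity.
    Unless it splits over the field generated by the roots of unity, its
    coefficients are cyclotomic, and a Galois conjugation that changes the
    2-part of the roots of unity by signs yields, for one of 2^(gamma-1) sign
    patterns, another relation with the same monomials; when no such conjugation
    is available, the 2-parts are trivial up to sign and the conjugation
    squaring the roots of odd order, iterated K times, gives a relation between
    the F^(2^K a).  The first kind of relation is not identically satisfied by
    minimality of the support, the second by a Wronskian estimate as soon as 2^K
    exceeds C(gamma-1, 2) ((l+1) D - 1), because distinct F^a have nonconstant
    ratios by multiplicative independence.  So each sign pattern contributes one
    hypersurface.  That 2^K still fits in the allowed degree needs only the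
    bound x^3 on the primorial of x >= 11, a Bonse inequality. *)

(** * Lower bound on primorials *)

Lemma primorialS n : primorial n.+1 = primorial n * (if prime n.+1 then n.+1 else 1).
Proof.
rewrite /primorial big_mkcond big_nat_recr //= -big_mkcond.
by [].
Qed.

Lemma primorial0 : primorial 0 = 1.
Proof. by rewrite /primorial big_mkcond big_nat1. Qed.

Lemma primorial_next m k : ~~ has prime (iota m.+1 k) -> prime (m + k).+1 ->
  primorial (m + k).+1 = primorial m * (m + k).+1.
Proof.
move=> np pk; rewrite primorialS pk; congr (_ * _).
elim: k np {pk} => [|k IH]; first by rewrite addn0.
rewrite -[k.+1]addn1 iotaD has_cat negb_or /= orbF => /andP[np pk].
by rewrite addn1 addnS primorialS -addSn (negPf pk) muln1 IH.
Qed.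

Lemma primorial_gt0 n : 0 < primorial n.
Proof. by apply: prodn_cond_gt0 => p /prime_gt0. Qed.

Lemma leq_primorial m n : m <= n -> primorial m <= primorial n.
Proof.
move=> /subnKC <-; elim: (n - m) => [|k IH]; first by rewrite addn0.
rewrite addnS primorialS; apply: leq_trans IH _; apply: leq_pmulr.
by case: ifP.
Qed.

Lemma primorialS_le n : primorial n.+1 <= n.+1 * primorial n.
Proof. by rewrite primorialS mulnC; case: ifP => _; rewrite ?mul1n // leq_pmull. Qed.

Lemma dvdn_primorial p n : prime p -> p <= n -> p %| primorial n.
Proof.
move=> pp pn; rewrite /primorial big_mkcond (bigD1_seq p) ?iota_uniq ?mem_index_iota //=.
by rewrite pp dvdn_mulr.
Qed.

(** Every prime counted here exceeds [y], so it contributes a factor at least [y + 1]. *)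
Lemma primorial_count y k :
  primorial y * y.+1 ^ count prime (iota y.+1 k) <= primorial (y + k).
Proof.
elim: k => [|k IH]; first by rewrite muln1 addn0.
rewrite -{1}[k.+1]addn1 iotaD count_cat /= addn0 addnS primorialS expnD mulnA.
apply: leq_mul IH _; rewrite addSn; case: (prime _) => //.
by rewrite expn1 ltnS leq_addr.
Qed.

(* Bonse's argument: the numbers [j * primorial y - 1] for [1 <= j <= y] have
   pairwise distinct smallest prime factors, all of them larger than [y]. *)
Lemma bonse_count x y : 2 < primorial y -> y * primorial y <= x ->
  y <= count prime (iota y.+1 (x - y)).
Proof.
set Q := primorial y => Q2 yx.
have yltx : y <= x by apply: leq_trans yx; rewrite leq_pmulr // /Q primorial_gt0.
pose f j := pdiv (j * Q - 1).
have N2 j : 0 < j -> 1 < j * Q - 1.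
  by move=> j0; have : Q <= j * Q by [rewrite leq_pmull]; lia.
have fp j : 0 < j -> prime (f j) by move=> j0; apply/pdiv_prime/N2.
have fcop j : 0 < j -> coprime (f j) Q.
  move=> j0; rewrite prime_coprime ?fp //; apply/negP => fQ.
  have := dvdn_sub (dvdn_mull j fQ) (pdiv_dvd (j * Q - 1)).
  rewrite subKn ?(dvdn1 (f j)); last by have := N2 _ j0; lia.
  by move/eqP=> f1; have := fp _ j0; rewrite f1.
have fy j : 0 < j -> y < f j.
  move=> j0; rewrite ltnNge; apply/negP => fjy.
  have := fcop j j0; rewrite prime_coprime ?fp //.
  by rewrite (dvdn_primorial (fp _ j0) fjy).
have inj : {in iota 1 y &, injective f}.
  have W i j : 0 < i -> i <= j -> j <= y -> f i = f j -> i = j.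
    move=> i0 ij jy fij; have j0 := leq_trans i0 ij.
    have : f j %| (j - i) * Q.
      have -> : (j - i) * Q = (j * Q - 1) - (i * Q - 1).
        by rewrite mulnBl; have := N2 _ i0; have := N2 _ j0; lia.
      by apply: dvdn_sub; [apply: pdiv_dvd | rewrite -fij; apply: pdiv_dvd].
    rewrite Gauss_dvdl ?fcop // => dv.
    case: (posnP (j - i)) => [|ji0]; first by lia.
    by have := dvdn_leq ji0 dv; have := fy _ j0; lia.
  move=> i j; rewrite !mem_iota add1n !ltnS => /andP[i0 iy] /andP[j0 jy] fij.
  by case: (leqP i j) => [ij|/ltnW ji]; [apply: W | apply/esym/W].
rewrite -[X in X <= _](size_iota 1 y) -(size_map f) -size_filter.
apply: uniq_leq_size; first by rewrite map_inj_in_uniq ?iota_uniq.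
move=> _ /mapP[j jI ->]; rewrite mem_iota add1n ltnS in jI; case/andP: jI => j0 jy.
rewrite mem_filter fp //= mem_iota fy //= addSn subnKC // ltnS.
apply: leq_trans yx; apply: leq_trans (pdiv_leq _) _; first by have := N2 _ j0; lia.
by apply: leq_trans (leq_subr _ _) _; rewrite leq_mul2r jy orbT.
Qed.

(** Primes above 3 are congruent to 1 or 5 modulo 6, so six consecutive integers contain at most two
    of them. *)
Lemma primorial_two_mod_six n : 4 <= n -> primorial (n + 6) <= primorial n * (n + 6) ^ 2.
Proof.
move=> n4.
pose t m := if (m %% 6 == 1) || (m %% 6 == 5) then n + 6 else 1.
have H m : n <= m < n + 6 -> primorial m.+1 <= primorial m * t m.+1.
  move=> /andP[nm mn]; rewrite primorialS leq_mul2l; apply/orP; right.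
  rewrite /t; case: ifP => pm; last by case: ifP => _ //; rewrite addnS.
  have nd d : 1 < d < 5 -> (d %| m.+1) = false.
    by move=> d5; apply/negP => dm; case/primeP: pm => _ /(_ d dm); lia.
  have n2 := nd 2 isT; have n3 := nd 3 isT.
  case: ifP => [_|]; first by lia.
  move: n2 n3; rewrite /dvdn; lia.
have : primorial (n + 6) <= primorial n * (t n.+1 * t n.+2 * t n.+3 * t n.+4 * t (n.+4.+1) * t (n.+4.+2)).
  have L i : i < 6 -> primorial (n + i).+1 <= primorial (n + i) * t (n + i).+1.
    by move=> i6; apply: H; rewrite leq_addr ltn_add2l.
  have := L 0 isT; have := L 1 isT; have := L 2 isT; have := L 3 isT.
  have := L 4 isT; have := L 5 isT; rewrite !addnS !addn0 !mulnA => l5 l4 l3 l2 l1 l0.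
  apply: leq_trans l5 _; rewrite leq_mul2r; apply/orP; right.
  apply: leq_trans l4 _; rewrite leq_mul2r; apply/orP; right.
  apply: leq_trans l3 _; rewrite leq_mul2r; apply/orP; right.
  apply: leq_trans l2 _; rewrite leq_mul2r; apply/orP; right.
  by apply: leq_trans l1 _; rewrite leq_mul2r l0 orbT.
move/leq_trans; apply; rewrite leq_mul2l; apply/orP; right.
rewrite /t; move: (n + 6) => N; rewrite expnS expn1.
have : n %% 6 < 6 by rewrite ltn_pmod.
have mE i : (n + i) %% 6 = (n %% 6 + i) %% 6 by rewrite modnDml.
rewrite -[n.+1]addn1 -!addnS !mE; case: (n %% 6) => [|[|[|[|[|[|]]]]]] //= _; rewrite ?mul1n ?muln1 //.
Qed.

(** The bound on [k] is the one needed for [y ^ (6 + 2 * k) <= y ^ (y - 1)] in [cube_le_primorial].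
    The induction goes by steps of 6: each raises [k] by 2, hence [2 * k] by 4 only. *)
Lemma primorial_ub y : 15 <= y -> exists2 k, 2 * k + 7 <= y & primorial y.-1 <= y ^ k.
Proof.
have p13 : primorial 13 = 2 * 3 * 5 * 7 * 11 * 13.
  by rewrite !primorialS primorial0 /= !muln1 !mul1n.
elim/ltn_ind: y => y IH y15.
have [y21|y21] := leqP 21 y.
  have [k ky kP] := IH (y - 6) (ltac:(lia)) (ltac:(lia)).
  exists (k + 2); first by lia.
  have -> : y.-1 = (y - 6).-1 + 6 by lia.
  apply: leq_trans (primorial_two_mod_six _) _; first by lia.
  rewrite expnD; apply: leq_mul; last by rewrite leq_sqr; lia.
  by apply: leq_trans kP _; case: (k) => // k'; rewrite leq_exp2r //; lia.
have : y \in iota 15 6 by rewrite mem_iota y15.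
have p14 : primorial 14 = primorial 13 by rewrite primorialS muln1.
have p15 : primorial 15 = primorial 13 by rewrite primorialS muln1.
have p16 : primorial 16 = primorial 13 by rewrite primorialS muln1.
have p17 : primorial 17 = primorial 13 * 17 by rewrite primorialS p16.
have p18 : primorial 18 = primorial 13 * 17 by rewrite primorialS muln1 p17.
have p19 : primorial 19 = primorial 13 * 17 * 19 by rewrite primorialS p18.
rewrite !inE => /or4P[/eqP->|/eqP->|/eqP->|].
- by exists 4 => //; rewrite p14 p13; lia.
- by exists 4 => //; rewrite p15 p13; lia.
- by exists 4 => //; rewrite p16 p13; lia.
case/or3P => /eqP->.
- by exists 5 => //; rewrite p17 p13; lia.
- by exists 5 => //; rewrite p18 p13; lia.
- by exists 6 => //; rewrite p19 p13; lia.
Qed.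

(** Up to 61 a few explicit primorials suffice; beyond, Bonse's argument compares [x] with the
    primorial of a much smaller [y]. *)
Lemma cube_le_primorial x : 11 <= x -> x ^ 3 <= primorial x.
Proof.
move=> x11.
have p11 : primorial 11 = 2 * 3 * 5 * 7 * 11.
  by rewrite !primorialS primorial0 /= !muln1 !mul1n.
have p13 : primorial 13 = 2 * 3 * 5 * 7 * 11 * 13.
  by rewrite !primorialS primorial0 /= !muln1 !mul1n.
have p17 : primorial 17 = primorial 13 * 17 by exact: (@primorial_next 13 3).
have p19 : primorial 19 = primorial 17 * 19 by exact: (@primorial_next 17 1).
have p23 : primorial 23 = primorial 19 * 23 by exact: (@primorial_next 19 3).
have p29 : primorial 29 = primorial 23 * 29 by exact: (@primorial_next 23 5).
have p31 : primorial 31 = primorial 29 * 31 by exact: (@primorial_next 29 1).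
have p37 : primorial 37 = primorial 31 * 37 by exact: (@primorial_next 31 5).
have p41 : primorial 41 = primorial 37 * 41 by exact: (@primorial_next 37 3).
have p43 : primorial 43 = primorial 41 * 43 by exact: (@primorial_next 41 1).
have p47 : primorial 47 = primorial 43 * 47 by exact: (@primorial_next 43 3).
have p53 : primorial 53 = primorial 47 * 53 by exact: (@primorial_next 47 5).
have p59 : primorial 59 = primorial 53 * 59 by exact: (@primorial_next 53 5).
have p61 : primorial 61 = primorial 59 * 61 by exact: (@primorial_next 59 1).
have small a b : a <= x -> x <= b -> b ^ 3 <= primorial a -> x ^ 3 <= primorial x.
  move=> ax xb H; apply: leq_trans (leq_primorial ax); apply: leq_trans H.
  by rewrite leq_exp2r.
have [x12|x12] := leqP x 12; first by apply: (small 11 12) => //; rewrite p11; lia.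
have [x31|x31] := leqP x 31; first by apply: (small 13 31) => //; rewrite p13; lia.
have [x61|x61] := leqP x 61; first by apply: (small 31 61) => //; [exact: ltnW | rewrite p31 p29 p23 p19 p17 p13; lia].
have ex_y : exists y, count prime (iota y.+1 (x - y)) < y.
  by exists x; rewrite subnn /=; lia.
(* Minimality of [y] gives at least [y - 1] primes in [y, x], while
   [bonse_count] bounds [x] by [y * primorial y]. *)
case: (ex_minnP ex_y) => y Py ymin.
have yx : y <= x by apply: ymin; rewrite subnn /=; lia.
(* If [y] were at most 2, the primes 3, 5, 7 would already lie in the interval above [y], against
   [Py]. *)
have y3 : 3 <= y.
  rewrite leqNgt; apply/negP => y3.
  have : 3 <= count prime (iota y.+1 (x - y)).
    have -> : x - y = (7 - y) + (x - 7) by lia.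
    rewrite iotaD count_cat; apply: leq_trans (leq_addr _ _).
    by case: y y3 {Py ymin yx} => [|[|[|]]].
  by lia.
have cy : y.-1 <= count prime (iota y (x - y.-1)).
  rewrite leqNgt; apply/negP => H.
  have := ymin y.-1; rewrite prednK; last by lia.
  by move=> /(_ H); lia.
have Qx : primorial y.-1 * y ^ y.-1 <= primorial x.
  have := primorial_count y.-1 (x - y.-1); rewrite prednK; last by lia.
  rewrite subnKC; last by lia.
  apply: leq_trans; rewrite leq_mul2l; apply/orP; right.
  by rewrite leq_exp2l //; lia.
have Q3 : 2 < primorial y.
  by apply: leq_trans (leq_primorial y3); rewrite !primorialS primorial0.
have xy : x < y * primorial y.
  by rewrite ltnNge; apply/negP => /(bonse_count Q3); lia.
have Qy : primorial y <= y * primorial y.-1.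
  by have := primorialS_le y.-1; rewrite prednK //; lia.
have xy2 : x <= y ^ 2 * primorial y.-1.
  by apply: leq_trans (ltnW xy) _; rewrite expnS expn1 -mulnA leq_mul2l Qy orbT.
(* With [Q = primorial y.-1] the cube of [x] is at most [Q * (y ^ 6 * Q ^ 2)], and [primorial_ub]
   bounds the second factor by [y ^ y.-1], which [Qx] provides. *)
have [y15|y15] := leqP 15 y.
  have [k ky kP] := primorial_ub y15.
  apply: leq_trans Qx.
  apply: (@leq_trans ((y ^ 2 * primorial y.-1) ^ 3)); first by rewrite leq_exp2r.
  rewrite expnMn -expnM [primorial _ ^ 3]expnS mulnCA leq_mul2l; apply/orP; right.
  apply: (@leq_trans (y ^ 6 * (y ^ k) ^ 2)); first by rewrite leq_mul2l leq_exp2r // kP orbT.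
  by rewrite -expnM -expnD leq_exp2l; lia.
(* For [y <= 14], [x] is bounded by an explicit constant whose cube is below the primorial of 61. *)
apply: leq_trans (leq_primorial (ltnW x61)).
have : primorial y.-1 <= primorial 13 by apply: leq_primorial; lia.
rewrite p61 p59 p53 p47 p43 p41 p37 p31 p29 p23 p19 p17 p13 => Q13.
have : x <= 14 ^ 2 * (2 * 3 * 5 * 7 * 11 * 13).
  by apply: leq_trans xy2 _; apply: leq_mul => //; rewrite leq_exp2r //; lia.
move=> xB; apply: (@leq_trans ((14 ^ 2 * (2 * 3 * 5 * 7 * 11 * 13)) ^ 3)); first by rewrite leq_exp2r.
by lia.
Qed.

(** * Size of [gamma] and choice of the exponent [K] *)

(** For fixed [D ^ l] the binomial coefficient increases with the first parameter, so it is at least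
    C(D^l + 2, 2). *)
Lemma gamma_ge l D : 1 <= l -> (D ^ l + 2) * (D ^ l + 1) <= 2 * gamma l D.
Proof.
move=> l1; rewrite /gamma; set m := D ^ l.
apply: (@leq_trans (2 * 'C(m + 2, 2))).
  by have := mul_bin_diag (m + 2) 1; rewrite bin1 => <-; rewrite leq_mul2l; apply/orP; right; lia.
rewrite leq_mul2l /= -(bin_sub (leq_addl m 2)) addnK -[X in _ <= X]bin_sub ?leq_addr //.
by rewrite addKn; apply: leq_bin2l; lia.
Qed.

Lemma gamma_ge3 l D : 1 <= l -> 1 <= D -> 3 <= gamma l D.
Proof.
move=> l1 D1; have := gamma_ge D l1.
have : 1 <= D ^ l by rewrite expn_gt0 D1.
by move: (D ^ l) => m; nia.
Qed.

Lemma exponent_choice l D : 1 <= l -> 1 <= D ->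
  exists K, [/\ 0 < K, 'C((gamma l D).-1, 2) * ((l + 1) * D - 1) < 2 ^ K
    & 2 ^ K + 1 <= (l + 1) * primorial (gamma l D)].
Proof.
move=> l1 D1; have g3 := gamma_ge3 l1 D1.
have binE : 2 * 'C((gamma l D).-1, 2) = (gamma l D).-1 * (gamma l D).-2.
  by have := mul_bin_diag (gamma l D).-1 1; rewrite bin1 => <-.
pose B := 'C((gamma l D).-1, 2) * ((l + 1) * D - 1).
have B0 : 0 < B by rewrite /B muln_gt0 bin_gt0; apply/andP; split; [lia | nia].
(* Some power of two lies above [B] and is at most [2 * B], so it is enough that [2 * B + 1] fits
   into the allowed degree. *)
have main : (gamma l D).-1 * (gamma l D).-2 * ((l + 1) * D - 1) + 1 <= (l + 1) * primorial (gamma l D) ->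
    exists K, [/\ 0 < K, B < 2 ^ K & 2 ^ K + 1 <= (l + 1) * primorial (gamma l D)].
  rewrite -binE -mulnA -/B => H.
  have /andP[K1 K2] := trunc_log_bounds (isT : 1 < 2) B0.
  exists (trunc_log 2 B).+1; split=> //.
  by apply: leq_trans H; rewrite leq_add2r expnS leq_mul2l.
have gD := gamma_ge D l1.
have Dm : D <= D ^ l by rewrite -{1}(expn1 D); case: (D) D1 => // D' _; apply: leq_pexp2l.
have [g11|g11] := leqP 11 (gamma l D).
  apply: main; have Q3 := cube_le_primorial g11.
  apply: (@leq_trans ((l + 1) * gamma l D ^ 3)); last by rewrite leq_mul2l Q3 orbT.
  have Dg : D <= gamma l D by move: gD Dm; move: (D ^ l) (gamma l D) => m g; nia.
  move: (gamma l D) g11 Dg {Q3 gD B B0 binE g3} => g g11 Dg.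
  apply: (@leq_trans (g * g * ((l + 1) * g))); last by rewrite !expnS expn0; nia.
  have a1 : g.-1 * g.-2 <= g * (g - 1) by nia.
  have a2 : (l + 1) * D - 1 <= (l + 1) * g by nia.
  apply: leq_trans (_ : g * (g - 1) * ((l + 1) * g) + 1 <= _); last by nia.
  by rewrite leq_add2r leq_mul.
have m3 : D ^ l <= 3 by move: gD g11; move: (D ^ l) (gamma l D) => m g; nia.
have p3 : primorial 3 = 6 by rewrite !primorialS primorial0.
have p4 : primorial 4 = 6 by rewrite primorialS p3.
have p5 : primorial 5 = 6 * 5 by rewrite primorialS p4.
have p6 : primorial 6 = 6 * 5 by rewrite primorialS p5 muln1.
have p7 : primorial 7 = 6 * 5 * 7 by rewrite primorialS p6.
have p8 : primorial 8 = 6 * 5 * 7 by rewrite primorialS p7 muln1.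
have p9 : primorial 9 = 6 * 5 * 7 by rewrite primorialS p8 muln1.
have p10 : primorial 10 = 6 * 5 * 7 by rewrite primorialS p9 muln1.
have [D2|D2] := leqP D 1.
  have E : D = 1 by lia.
  have gE : gamma l D = l + 2 by rewrite /gamma E exp1n addn1 binSn; lia.
  apply: main; move: g11; rewrite gE E => g11.
  have : l \in iota 1 8 by rewrite mem_iota l1; lia.
  rewrite !inE => /orP[/eqP->|/orP[/eqP->|/orP[/eqP->|/orP[/eqP->|/orP[/eqP->|/orP[/eqP->|/orP[/eqP->|/eqP->]]]]]]].
  - by rewrite (p3 : primorial (1 + 2) = _); lia.
  - by rewrite (p4 : primorial (2 + 2) = _); lia.
  - by rewrite (p5 : primorial (3 + 2) = _); lia.
  - by rewrite (p6 : primorial (4 + 2) = _); lia.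
  - by rewrite (p7 : primorial (5 + 2) = _); lia.
  - by rewrite (p8 : primorial (6 + 2) = _); lia.
  - by rewrite (p9 : primorial (7 + 2) = _); lia.
  - by rewrite (p10 : primorial (8 + 2) = _); lia.
have lE : l = 1.
  apply/eqP; rewrite eqn_leq l1 andbT leqNgt; apply/negP => l2.
  have : D ^ 2 <= D ^ l by rewrite leq_exp2l.
  by move: m3; move: (D ^ l) => m; rewrite expnS expn1; nia.
move: m3; rewrite lE expn1 => D3.
(* For [l = 1], [D = 2] the criterion [main] just fails, with 61 against 60; [2 ^ 5 = 32] lies
   directly between the bounds 30 and 59. *)
have [D4|D4] := leqP D 2.
  have E : D = 2 by lia.
  have gE : gamma 1 2 = 6 by [].
  by exists 5; rewrite E gE p6; split.
have E : D = 3 by lia.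
have gE : gamma 1 3 = 10 by [].
by move: main; rewrite /B lE E gE p10; apply.
Qed.

Local Open Scope ring_scope.

(** * Comparison of the number of sign patterns with the stated bound *)

(** Since (1 + y/10)^10 is at most exp y, an upper bound on a logarithm reduces to an inequality
    between rational numbers. *)
Lemma ln_le_of_pow (R : realType) (x y : R) : 0 < x -> 0 <= y ->
  x <= (1 + y / 10%:R) ^+ 10 -> exp.ln x <= y.
Proof.
move=> x0 y0 H; rewrite -(exp.expRK y) exp.ler_ln ?posrE ?exp.expR_gt0 //.
apply: le_trans H _.
rewrite -{2}(_ : 10%:R * (y / 10%:R) = y); last by field.
rewrite exp.expRM_natl; apply: lerXn2r; rewrite ?nnegrE ?exp.expR_ge0 //.
  by apply: addr_ge0 => //; apply: divr_ge0.
exact: exp.expR_ge1Dx.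
Qed.

Lemma two_pow_le (R : realType) (g : nat) : (3 <= g)%N ->
  ((2 ^ g.-1)%N%:R : R) <= ((792%:R / 1000%:R) * g%:R / exp.ln (g%:R + 1)) ^+ g.
Proof.
move=> g3; rewrite natrX.
have g0 : (0 : R) < g%:R by rewrite ltr0n; apply: leq_trans g3.
have ln0 : 0 < exp.ln (g%:R + 1 : R) by apply: exp.ln_gt0; lra.
have base (y b : R) : 0 < y -> exp.ln (g%:R + 1) <= y -> 0 <= b -> b * y <= 792%:R / 1000%:R * g%:R ->
    b ^+ g <= ((792%:R / 1000%:R) * g%:R / exp.ln (g%:R + 1)) ^+ g.
  move=> y0 ly b0 H; apply: lerXn2r; rewrite ?nnegrE //.
    by rewrite divr_ge0 ?(ltW ln0) // mulr_ge0 ?(ltW g0) // divr_ge0.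
  by rewrite ler_pdivlMr //; apply: le_trans H; rewrite ler_wpM2l.
(* The tangent of the logarithm at 6 gives log(g + 1) <= 1.98 + (g - 5)/6, and 2 times 1.98 equals
   0.792 times 5: base 2 is admissible from [g = 5] on. *)
have [g5|] := leqP 5 g.
  apply: (@le_trans _ _ (2%:R ^+ g)); first by apply: ler_weXn2l; [lra | apply: leq_pred].
  have g5' : (5%:R : R) <= g%:R by rewrite ler_nat.
  have l6 : exp.ln (6%:R : R) <= 198%:R / 100%:R by apply: ln_le_of_pow; lra.
  apply: (base (198%:R / 100%:R + (g%:R - 5%:R) / 6%:R)); [lra | | lra | lra].
  have -> : (g%:R + 1 : R) = 6%:R * (1 + (g%:R - 5%:R) / 6%:R) by field.
  rewrite exp.lnM ?posrE; [|lra|lra].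
  by apply: lerD => //; apply: exp.le_ln1Dx; lra.
(* For [g = 3] and [g = 4] base 2 is too large. The exponent [g - 1] on the left leaves room: 1.59^3
   exceeds 4 and 1.81^4 exceeds 8. *)
case: g g3 g0 ln0 base => [|[|[|[|[|g]]]]] // _ _ _ base _.
  apply: le_trans (base (149%:R / 100%:R) (159%:R / 100%:R) _ _ _ _); [lra|lra| |lra|lra].
  by apply: ln_le_of_pow; lra.
apply: le_trans (base (175%:R / 100%:R) (181%:R / 100%:R) _ _ _ _); [lra|lra| |lra|lra].
by apply: ln_le_of_pow; lra.
Qed.

(** * Vanishing sums of roots of unity *)

Lemma prim_root_exists (C : numClosedFieldType) n :
  (0 < n)%N -> exists z : C, n.-primitive_root z.
Proof.
pose p : {poly C} := 'X^n - 1; have [r Dp] := closed_field_poly_normal p.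
move=> n_gt0; rewrite (monicP _) ?monicXnsubC // scale1r in Dp.
have rn1 : all n.-unity_root r by apply/allP=> z; rewrite -root_prod_XsubC -Dp.
have sz_r : (n < (size r).+1)%N.
  by rewrite -(size_prod_XsubC r id) -Dp size_XnsubC.
have [|z _ zP] := hasP (cyclic.has_prim_root n_gt0 rn1 _ sz_r); last by exists z.
by rewrite -separable_prod_XsubC -Dp separable_Xn_sub_1 // pnatr_eq0 -lt0n.
Qed.

Lemma root_Cyclotomic (C : numFieldType) n (z : C) :
  (0 < n)%N -> n.-primitive_root z -> root (map_poly intr 'Phi_n) z.
Proof.
move=> n_gt0 zP; apply/contraT => nz.
have zr d : (0 < d)%N ->
    root (\prod_(e <- divisors d) map_poly intr 'Phi_e) z = (z ^+ d == 1).
  move=> d0; rewrite -rmorph_prod prod_Cyclotomic // rmorphB /= map_polyXn rmorph1.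
  by rewrite rootE !hornerE subr_eq0.
have := zr n n_gt0; rewrite (prim_expr_order zP) eqxx => rz.
have : has (fun p => root p z) [seq map_poly intr 'Phi_e | e <- divisors n].
  rewrite -[has _ _]negbK -all_predC.
  have := root_bigmul z [seq map_poly intr 'Phi_e | e <- divisors n].
  by rewrite big_map rz => <-.
case/hasP => _ /mapP[e eD ->] ez.
have en : (e %| n)%N by rewrite dvdn_divisors.
have e0 := dvdn_gt0 n_gt0 en.
have : root (\prod_(e <- divisors e) map_poly intr 'Phi_e) z.
  rewrite (big_rem e) /= ?rootM ?ez //.
  by rewrite -dvdn_divisors.
rewrite zr // -(prim_order_dvd zP) => ne.
have E : e = n by apply/eqP; rewrite eqn_dvd en ne.
by rewrite -E ez in nz.
Qed.

Lemma ratr_Cyclotomic (C : numFieldType) n :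
  map_poly (ratr : rat -> C) (map_poly intr 'Phi_n) = map_poly intr 'Phi_n.
Proof. by rewrite -map_poly_comp; apply: eq_map_poly => x /=; rewrite ratr_int. Qed.

(** Irreducibility of the cyclotomic polynomial over the rationals: a root of [g] in [algC] is a
    primitive n-th root of unity, whose minimal polynomial is known to be cyclotomic. *)
Lemma Cyclotomic_irr (n : nat) (g : {poly rat}) : (0 < n)%N ->
  (1 < size g)%N -> g %| map_poly intr 'Phi_n -> map_poly intr 'Phi_n %| g.
Proof.
move=> n_gt0 sg gd.
have [z0 z0P] := C_prim_root_exists n_gt0.
have /closed_rootP[w wr] : size (map_poly (ratr : rat -> algC) g) != 1.
  by rewrite size_map_poly neq_ltn sg orbT.
have wp : n.-primitive_root w.
  rewrite -(root_cyclotomic z0P) -(Cintr_Cyclotomic z0P) -ratr_Cyclotomic.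
  by apply: root_dvdp wr; rewrite dvdp_map.
have [p [pE _] pP] := minCpolyP w.
have Ep : p = map_poly intr 'Phi_n.
  apply: (map_poly_inj (ratr : {rmorphism rat -> algC})).
  by rewrite -pE (minCpoly_cyclotomic wp) ratr_Cyclotomic (Cintr_Cyclotomic wp).
by rewrite -Ep -pP.
Qed.

(** * Conjugation of polynomial values at roots of unity *)

Section Conj.
Variable C : numClosedFieldType.

Local Notation ev p z := (map_poly (ratr : rat -> C) p).[z].

Lemma Cyclotomic_dvd n (z : C) (p : {poly rat}) : n.-primitive_root z ->
  ev p z = 0 -> map_poly intr 'Phi_n %| p.
Proof.
move=> zP pz; have n_gt0 := prim_order_gt0 zP.
set f : {poly rat} := map_poly intr 'Phi_n.
have fE := ratr_Cyclotomic C n : map_poly ratr f = _.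
have fz : root (map_poly (ratr : rat -> C) f) z by rewrite fE root_Cyclotomic.
have f0 : f != 0.
  by rewrite map_poly_eq0_id0 ?monic_neq0 ?Cyclotomic_monic // (monicP (Cyclotomic_monic n)) oner_eq0.
have gz : root (map_poly (ratr : rat -> C) (gcdp p f)) z.
  by rewrite gcdp_map root_gcd fz andbT; apply/eqP.
apply: (dvdp_trans (Cyclotomic_irr n_gt0 _ (dvdp_gcdr p f))); last exact: dvdp_gcdl.
rewrite -(size_map_poly (ratr : {rmorphism rat -> C})).
apply: (root_size_gt1 _ gz).
by rewrite map_poly_eq0 gcdp_eq0 negb_and f0 orbT.
Qed.

(** A rational polynomial vanishing at [z] is a multiple of the cyclotomic polynomial, which
    vanishes at [z ^+ k] as well. *)
Lemma conj_root n (z : C) k (p : {poly rat}) : n.-primitive_root z ->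
  coprime k n -> ev p z = 0 -> ev p (z ^+ k) = 0.
Proof.
move=> zP kn /(Cyclotomic_dvd zP) /dvdpP[q ->].
have zkP : n.-primitive_root (z ^+ k) by rewrite prim_root_exp_coprime.
have /eqP fz := root_Cyclotomic (prim_order_gt0 zP) zkP.
by rewrite rmorphM /= hornerM ratr_Cyclotomic fz mulr0.
Qed.

(** By irreducibility [p] is coprime to the cyclotomic polynomial, and a Bezout relation evaluated
    at [z] gives the inverse. *)
Lemma inv_root n (z : C) (p : {poly rat}) : n.-primitive_root z ->
  ev p z != 0 -> exists q : {poly rat}, (ev p z)^-1 = ev q z.
Proof.
move=> zP pz; have n_gt0 := prim_order_gt0 zP.
set f : {poly rat} := map_poly intr 'Phi_n.
have fE := ratr_Cyclotomic C n : map_poly ratr f = _.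
have /eqP fz := root_Cyclotomic n_gt0 zP.
have cop : coprimep p f.
  rewrite coprimep_def eqn_leq leqNgt; apply/andP; split.
    apply: contra pz => sg; apply/eqP.
    have := Cyclotomic_irr n_gt0 sg (dvdp_gcdr p f).
    move/dvdp_trans => /(_ _ (dvdp_gcdl p f)) /dvdpP[q ->].
    by rewrite rmorphM /= hornerM fE fz mulr0.
  rewrite lt0n size_poly_eq0 gcdp_eq0 negb_and.
  by apply/orP; left; apply: contra pz => /eqP->; rewrite rmorph0 horner0.
case/Bezout_eq1_coprimepP: cop => -[u v] /= uv; exists u.
have /(congr1 (fun p => ev p z)) := uv.
rewrite rmorphD !rmorphM rmorph1 /= !hornerE fE fz mulr0 addr0 => uz.
by apply: (mulIf pz); rewrite mulVf // uz.
Qed.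

(* Writing cyclotomic numbers as values at [z] of rational polynomials lets
   [z |-> z ^+ k] play the role of a Galois conjugation inside [C]. *)
Lemma conj_relation (I : finType) L k (z : C) (A : I -> {poly rat}) (w : I -> C) :
    (0 < L)%N -> coprime k L -> z ^+ L = 1 -> (forall i, w i ^+ L = 1) ->
  \sum_i ev (A i) z * w i = 0 -> \sum_i ev (A i) (z ^+ k) * w i ^+ k = 0.
Proof.
move=> L0 kL zL wL E.
have [x xP] := prim_root_exists C L0.
have [a za] := prim_rootP xP zL.
have wb i : exists b : 'I_L, w i == x ^+ b.
  by have [b ->] := prim_rootP xP (wL i); exists b.
pose b i := xchoose (wb i).
have bP i : w i = x ^+ b i by apply/eqP; exact: (xchooseP (wb i)).
(* [z] and all [w i] are powers of one primitive L-th root [x], so the whole sum is the value at [x]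
   of one polynomial, to which [conj_root] applies. *)
pose p : {poly rat} := \sum_i (A i \Po 'X^a) * 'X^(b i).
have evp y : ev p y = \sum_i ev (A i) (y ^+ a) * y ^+ b i.
  rewrite rmorph_sum horner_sum; apply: eq_bigr => i _.
  by rewrite rmorphM /= map_comp_poly !map_polyXn /= hornerM horner_comp !hornerE.
have : ev p (x ^+ k) = 0.
  apply: (conj_root xP kL); rewrite evp -za.
  by under eq_bigr do rewrite -bP.
rewrite evp; under eq_bigr do
  rewrite exprAC -za exprAC -bP.
by [].
Qed.
End Conj.

(** * Roots of unity and the cyclotomic field *)

Section Torsion.
Variable C : numClosedFieldType.

Local Notation ev p z := (map_poly (ratr : rat -> C) p).[z].

Definition is_unity (x : C) := exists2 n, (0 < n)%N & x ^+ n = 1.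

(** Membership in the field generated over the rationals by all roots of unity; one root of unity
    suffices for each element. *)
Definition is_cyclotomic (x : C) :=
  exists n z (A : {poly rat}), n.-primitive_root z /\ x = ev A z.

Lemma is_unity_neq0 x : is_unity x -> x != 0.
Proof.
by case=> n n0 xn; apply/eqP => x0; move/eqP: xn; rewrite x0 expr0n gtn_eqF // eq_sym oner_eq0.
Qed.

Lemma is_unityM x y : is_unity x -> is_unity y -> is_unity (x * y).
Proof.
move=> [n n0 xn] [m m0 ym]; exists (n * m)%N; first by rewrite muln_gt0 n0.
by rewrite exprMn exprM xn expr1n mulnC exprM ym expr1n mulr1.
Qed.

Lemma is_unityV x : is_unity x -> is_unity x^-1.
Proof. by move=> [n n0 xn]; exists n; rewrite // exprVn xn invr1. Qed.

Lemma is_unity_common (I : finType) (w : I -> C) : (forall i, is_unity (w i)) ->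
  exists2 N, (0 < N)%N & forall i, w i ^+ N = 1.
Proof.
move=> wu.
have /fin_all_exists[n nP] : forall i, exists n, (0 < n)%N && (w i ^+ n == 1).
  by move=> i; have [n n0 wn] := wu i; exists n; rewrite n0 wn eqxx.
exists (\prod_i n i)%N => [|i].
  by rewrite prodn_gt0 // => i; case/andP: (nP i).
rewrite (bigD1 i) //= exprM; case/andP: (nP i) => _ /eqP->; exact: expr1n.
Qed.

(** The finitely many roots of unity involved are powers of a single one, so all the numbers become
    values of polynomials at one point. *)
Lemma is_cyclotomic_common (I : finType) (x : I -> C) :
    (forall i, is_cyclotomic (x i)) ->
  exists n z (A : I -> {poly rat}), n.-primitive_root z /\ forall i, x i = ev (A i) z.
Proof.
move=> xc.
have /fin_all_exists[n /fin_all_exists[z /fin_all_exists[A AP]]] := xc.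
have zu i : is_unity (z i).
  by have [zP _] := AP i; exists (n i); rewrite ?(prim_order_gt0 zP) ?(prim_expr_order zP).
have [N N0 zN] := is_unity_common zu.
have [y yP] := prim_root_exists C N0.
have /fin_all_exists[b bP] : forall i, exists b : 'I_N, z i = y ^+ b.
  by move=> i; have [b ->] := prim_rootP yP (zN i); exists b.
exists N, y, (fun i => A i \Po 'X^(b i)); split=> // i.
by rewrite map_comp_poly map_polyXn horner_comp hornerXn -bP; have [_ ->] := AP i.
Qed.

Lemma is_cyclotomic_unity x : is_unity x -> is_cyclotomic x.
Proof.
move=> [n n0 xn]; have [z zP] := prim_root_exists C n0.
have [b ->] := prim_rootP zP xn.
by exists n, z, 'X^b; rewrite map_polyXn hornerXn.
Qed.

Lemma is_cyclotomic0 : is_cyclotomic 0.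
Proof.
have [z zP] := prim_root_exists C (ltn0Sn 0).
by exists 1%N, z, 0; rewrite rmorph0 horner0.
Qed.

Lemma is_cyclotomic1 : is_cyclotomic 1.
Proof. by apply: is_cyclotomic_unity; exists 1%N. Qed.

Lemma is_cyclotomic_pair x y : is_cyclotomic x -> is_cyclotomic y ->
  exists n z (A B : {poly rat}), [/\ n.-primitive_root z, x = ev A z & y = ev B z].
Proof.
move=> xc yc.
have [|n [z [A [zP E]]]] := @is_cyclotomic_common bool (fun b => if b then x else y).
  by case.
by exists n, z, (A true), (A false); split; rewrite -?E.
Qed.

Lemma is_cyclotomicM x y : is_cyclotomic x -> is_cyclotomic y -> is_cyclotomic (x * y).
Proof.
move=> xc yc; have [n [z [A [B [zP -> ->]]]]] := is_cyclotomic_pair xc yc.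
by exists n, z, (A * B); rewrite rmorphM hornerM.
Qed.

Lemma is_cyclotomicB x y : is_cyclotomic x -> is_cyclotomic y -> is_cyclotomic (x - y).
Proof.
move=> xc yc; have [n [z [A [B [zP -> ->]]]]] := is_cyclotomic_pair xc yc.
by exists n, z, (A - B); rewrite rmorphB !hornerE.
Qed.

Lemma is_cyclotomic_sum (I : finType) (x : I -> C) :
  (forall i, is_cyclotomic (x i)) -> is_cyclotomic (\sum_i x i).
Proof.
move=> /is_cyclotomic_common[n [z [A [zP E]]]].
exists n, z, (\sum_i A i); split=> //.
by rewrite rmorph_sum horner_sum; apply: eq_bigr => i _; apply: E.
Qed.

Lemma is_cyclotomicV x : is_cyclotomic x -> is_cyclotomic x^-1.
Proof.
move=> [n [z [A [zP ->]]]]; have [->|nz] := eqVneq (ev A z) 0.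
  by rewrite invr0; apply: is_cyclotomic0.
by have [q ->] := inv_root zP nz; exists n, z, q.
Qed.

(* Expanding the coefficients on a family that is linearly independent over the
   field generated by the roots of unity splits the relation [a] into relations
   with cyclotomic coefficients. *)
Lemma cyclotomic_component n (a : 'I_n.+1 -> C) : a ord0 = 1 ->
  (exists2 b : 'I_n.+1 -> C, (forall l, ~ (b =1 fun i => l * a i)) &
     forall w, (forall i, is_unity (w i)) ->
       \sum_i a i * w i = 0 -> \sum_i b i * w i = 0) \/
  (forall i, is_cyclotomic (a i)).
Proof.
move=> a0.
(* The induction shortens an expansion of [a] on a family [e] with cyclotomic coefficients; [kappa]
   absorbs the multipliers used in eliminations. *)
have [r] : exists r (kappa : C) (e : 'I_r -> C) (b : 'I_r -> 'I_n.+1 -> C),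
    [/\ kappa != 0, forall k i, is_cyclotomic (b k i)
       & forall i, kappa * a i = \sum_k e k * b k i].
  exists n.+1, 1, a, (fun k i => (k == i)%:R); split; rewrite ?oner_eq0 //.
    by move=> k i; case: eqP => _; [apply: is_cyclotomic1 | apply: is_cyclotomic0].
  move=> i; rewrite mul1r (bigD1 i) //= eqxx mulr1 big1 ?addr0 // => j /negPf->.
  by rewrite mulr0.
elim: r => [|r IH] [kappa [e [b [k0 bc E]]]].
  have := E ord0; rewrite a0 big_ord0 mulr1 => /eqP; by rewrite (negPf k0).
(* A cyclotomic dependence among the [e k] allows [e j] to be eliminated. *)
have [[g [gc [j gj] gE]]|indep] := boolp.EM (exists g : 'I_r.+1 -> C,
  [/\ forall k, is_cyclotomic (g k), exists j, g j != 0 & \sum_k e k * g k = 0]).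
  apply: IH; exists (g j * kappa), (fun k => e (lift j k)).
  exists (fun k i => g j * b (lift j k) i - g (lift j k) * b j i).
  split; first by rewrite mulf_neq0.
    by move=> k i; apply: is_cyclotomicB; apply: is_cyclotomicM.
  move=> i; rewrite -mulrA E (bigD1_ord j) //=.
  have -> : \sum_(k < r) e (lift j k) * (g j * b (lift j k) i - g (lift j k) * b j i)
    = g j * (\sum_(k < r) e (lift j k) * b (lift j k) i)
      - b j i * (\sum_(k < r) e (lift j k) * g (lift j k)).
    by rewrite !mulr_sumr -sumrB; apply: eq_bigr => k _; ring.
  have -> : \sum_(k < r) e (lift j k) * g (lift j k) = - (e j * g j).
    by apply/eqP; rewrite -addr_eq0 addrC; move: gE; rewrite (bigD1_ord j) /= => [->|].
  by rewrite mulrDr; ring.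
(* For roots of unity [w] the sums of the [b k i * w i] are cyclotomic, so independence of [e] makes
   each of them vanish. *)
have vanish k (w : 'I_n.+1 -> C) : (forall i, is_unity (w i)) ->
    \sum_i a i * w i = 0 -> \sum_i b k i * w i = 0.
  move=> wu aw; apply/eqP/contraT => nz; case: indep.
  exists (fun k => \sum_i b k i * w i); split; last 2 first.
  - by exists k.
  - transitivity (kappa * (\sum_i a i * w i)); last by rewrite aw mulr0.
    rewrite mulr_sumr; under eq_bigr do rewrite mulr_sumr.
    rewrite exchange_big /=; apply: eq_bigr => i _; rewrite mulrA E mulr_suml.
    by apply: eq_bigr => k' _; rewrite mulrA.
  by move=> k'; apply: is_cyclotomic_sum => i; apply/is_cyclotomicM/is_cyclotomic_unity.
(* If all components are proportional to [a], one with nonzero entry at [ord0] shows, as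
   [a ord0 = 1], that [a] itself is cyclotomic. *)
have [[k kP]|prop] := boolp.EM (exists k, forall l, ~ (b k =1 fun i => l * a i)).
  by left; exists (b k) => //; apply: vanish.
right=> i.
have [k bk0] : exists k, b k ord0 != 0.
  apply/existsP/contraT; rewrite negb_exists => /forallP b0.
  have := E ord0; rewrite a0 mulr1 big1 => [k00|k _]; first by rewrite k00 eqxx in k0.
  by move/negPn/eqP: (b0 k) => ->; rewrite mulr0.
have [l lE] : exists l, b k =1 fun i => l * a i.
  by apply: boolp.contrapT => nl; case: prop; exists k => l lE; case: nl; exists l.
have l0 : b k ord0 = l by rewrite lE a0 mulr1.
have -> : a i = b k i / b k ord0 by rewrite lE l0 mulrAC mulfV ?mul1r // -l0.
by apply/is_cyclotomicM/is_cyclotomicV.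
Qed.

(* [m] measures the 2-part of the cyclotomic field of the coefficients once the
   roots of unity [theta] are factored out.  When [m] is minimal and positive,
   [z |-> - z] cannot fix the relation, see [twisted_rep_descent]. *)
Definition twisted_rep n (a : 'I_n.+1 -> C) m :=
  exists (M : nat) (z : C) (theta : 'I_n.+1 -> C) (A : 'I_n.+1 -> {poly rat}),
    [/\ odd M, (2 ^ m * M).-primitive_root z,
        forall i, is_unity (theta i), theta ord0 = 1 /\ A ord0 = 1
      & forall i, a i = theta i * ev (A i) z].

Lemma odd_part n : (0 < n)%N -> exists l M, odd M /\ n = (2 ^ l * M)%N.
Proof.
move=> n0; have [M cM E] := pfactor_coprime (isT : prime 2) n0.
by exists (logn 2 n), M; rewrite -coprime2n mulnC.
Qed.

Lemma twisted_rep_exists n (a : 'I_n.+1 -> C) :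
  a ord0 = 1 -> (forall i, is_cyclotomic (a i)) -> exists m, twisted_rep a m.
Proof.
move=> a0 /is_cyclotomic_common[N [z [A [zP E]]]].
have [l [M [oM NE]]] := odd_part (prim_order_gt0 zP).
exists l, M, z, (fun=> 1), (fun i => if i == ord0 then 1 else A i).
split; rewrite -?NE // => i; first by exists 1%N; rewrite ?expr1.
by rewrite mul1r; case: eqP => [->|]; rewrite ?rmorph1 ?hornerC.
Qed.

Lemma ev_even_odd (p : {poly rat}) (z : C) :
  exists E O : {poly rat}, ev p z = ev E (z ^+ 2) + ev O (z ^+ 2) * z /\
    ev p (- z) = ev E (z ^+ 2) - ev O (z ^+ 2) * z.
Proof.
exists (even_poly p), (odd_poly p).
have F y : ev p y = ev (even_poly p) (y ^+ 2) + ev (odd_poly p) (y ^+ 2) * y.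
  rewrite -{1}(poly_even_odd p) rmorphD rmorphM /= !map_comp_poly map_polyXn map_polyX.
  by rewrite !hornerE !horner_comp !hornerE.
by split; rewrite F // sqrrN mulrN.
Qed.

Lemma sign_of_sqr1 (u : C) : u ^+ 2 = 1 -> u = (-1) ^+ (u != 1).
Proof.
move/eqP; rewrite sqrf_eq1 => /orP[] /eqP->; first by rewrite eqxx.
by rewrite eq_sym -addr_eq0 (_ : 1 + 1 = 2%:R) // pnatr_eq0.
Qed.

(** Comparison at [ord0] gives [l = 1], so each value of [A i] is even or odd under [z |-> - z]. In
    the odd case a factor [z] moves into [theta i]; what remains are polynomials in [z ^+ 2], whose
    order has one factor 2 less. *)
Lemma twisted_rep_descent n (a : 'I_n.+1 -> C) m M z theta (A : _ -> {poly rat}) s l :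
    odd M -> (2 ^ m.+1 * M).-primitive_root z ->
    (forall i, is_unity (theta i)) -> theta ord0 = 1 -> A ord0 = 1 -> s ord0 = false ->
    (forall i, a i = theta i * ev (A i) z) -> a ord0 = 1 ->
    (forall i : 'I_n.+1, ev (A i) (- z) * (-1) ^+ (s i : bool) * theta i = l * a i) ->
  twisted_rep a m.
Proof.
move=> oM zP tu t0 A0 s0 aE a0 H.
have l1 : l = 1 by move: (H ord0); rewrite s0 A0 t0 a0 rmorph1 hornerC !mulr1.
have z0 : z != 0 by rewrite (prim_root_eq0 zP) -lt0n (prim_order_gt0 zP).
have z2P : (2 ^ m * M).-primitive_root (z ^+ 2).
  have P0 : (0 < 2 ^ m * M)%N by rewrite muln_gt0 expn_gt0 /= odd_gt0.
  rewrite expnS -mulnA in zP.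
  by have := dvdn_prim_root zP (dvdn_mull 2 (dvdnn _)); rewrite mulnK.
have zu : is_unity z by exists (2 ^ m.+1 * M)%N; [apply: prim_order_gt0 zP|apply: prim_expr_order].
have two : (2%:R : C) != 0 by rewrite pnatr_eq0.
have /fin_all_exists[B BP] : forall i, exists B : {poly rat},
    a i = (theta i * z ^+ s i) * ev B (z ^+ 2).
  move=> i; have [E [O [e1 e2]]] := ev_even_odd (A i) z.
  have := H i; rewrite l1 mul1r aE e1 e2 mulrC => /(mulfI (is_unity_neq0 (tu i))).
  case: (s i) => /= Q.
    exists O; rewrite expr1.
    suff -> : ev E (z ^+ 2) = 0 by rewrite add0r; ring.
    by apply: (mulfI two); move: Q => /eqP; rewrite -subr_eq0 => /eqP Q; rewrite mulr0 -[RHS]oppr0 -Q; ring.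
  exists E; rewrite expr0 mulr1.
  suff -> : ev O (z ^+ 2) = 0 by rewrite mul0r addr0.
  apply: (mulIf z0); apply: (mulfI two).
  by move: Q => /eqP; rewrite -subr_eq0 => /eqP Q; rewrite mul0r mulr0 -[RHS]oppr0 -Q; ring.
exists M, (z ^+ 2), (fun i => theta i * z ^+ s i).
exists (fun i => if i == ord0 then 1 else B i); split=> //.
- by move=> i; apply: is_unityM => //; case: (s i) => //; exists 1%N; rewrite ?expr1.
- by rewrite t0 s0 mulr1.
- by move=> i; case: eqP => [->|]; rewrite // a0 t0 s0 rmorph1 hornerC !mulr1.
Qed.
End Torsion.

Lemma twisted_rep_minimal (C : numClosedFieldType) n (a : 'I_n.+1 -> C) m :
  twisted_rep a m -> exists2 m', twisted_rep a m' & forall k, (m' = k.+1) -> ~ twisted_rep a k.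
Proof.
elim: m => [|m IH] H; first by exists 0%N.
have [/IH//|nH] := boolp.EM (twisted_rep a m).
by exists m.+1 => // k [<-].
Qed.

(** * Second relations satisfied by the torsion solutions of a linear relation *)

Section TorsionCover.
Variable C : numClosedFieldType.

Local Notation ev p z := (map_poly (ratr : rat -> C) p).[z].

(** Let [e] be the 2-adic level of the solution twisted by [theta], and [m] that of the
    coefficients. If both are at most 1, the coefficients [cc] and the power [2 ^ K] arise.
    Otherwise, if [e <= m], the conjugation sends [z] to [- z] and gives [cb], not proportional to
    [a] by minimality of [m]; if [m < e], it fixes [z] and changes signs of the solution. *)
Lemma torsion_cover_twisted n (a : 'I_n.+1 -> C) K m : a ord0 = 1 -> (0 < K)%N ->
    twisted_rep a m -> (forall k, m = k.+1 -> ~ twisted_rep a k) ->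
  exists (kappa : nat) (c : ('I_n.+1 -> bool) -> 'I_n.+1 -> C),
  [/\ (kappa = 1%N /\ forall (s : 'I_n.+1 -> bool) l, s ord0 = false ->
          ~ (c s =1 fun i => l * a i)) \/
      (kappa = (2 ^ K)%N /\ forall s : 'I_n.+1 -> bool, s ord0 = false -> c s ord0 != 0)
    & forall w, (forall i, is_unity (w i)) -> w ord0 = 1 -> \sum_i a i * w i = 0 ->
      exists2 s : 'I_n.+1 -> bool, s ord0 = false &
        ((exists i, s i) /\ \sum_i (-1) ^+ s i * a i * w i = 0) \/
        \sum_i c s i * w i ^+ kappa = 0].
Proof.
move=> a0 K0 [M [z [theta [A [oM zP tu [t0 A0] aE]]]]] minm.
have M0 : (0 < M)%N by rewrite odd_gt0.
have tN0 i : theta i != 0 by apply: is_unity_neq0.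
have A0v y : ev (A ord0) y = 1 by rewrite A0 rmorph1 hornerC.
pose cb s i := ev (A i) (- z) * (-1) ^+ (s i : bool) * theta i.
pose cc s i := ev (A i) (z ^+ (2 ^ K + M)) * (-1) ^+ (s i : bool) * theta i ^+ (2 ^ K).
exists (if (m <= 1)%N then 2 ^ K else 1)%N, (if (m <= 1)%N then cc else cb).
split.
  case: ltnP => m1; last by right; split=> // s s0; rewrite /cc A0v s0 t0 expr1n !mul1r oner_eq0.
  left; split=> // s l s0 sE; case: m m1 zP minm => // m _ zP /(_ m erefl); apply.
  exact: (twisted_rep_descent (s := s) oM zP tu t0 A0 s0 aE a0 sE).
move=> w wu w0 aw.
pose v i := theta i * w i.
have vu i : is_unity (v i) by apply: is_unityM.
have v0 : v ord0 = 1 by rewrite /v t0 w0 mulr1.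
have wE i : w i = (theta i)^-1 * v i by rewrite /v mulKf.
have [N N0 vN] := is_unity_common vu.
(* The factor [M] makes the odd part [Lo] a multiple of [M], so that powers of [z] are controlled
   together with those of [v]. *)
have NM0 : (0 < N * M)%N by rewrite muln_gt0 N0.
have [l [Lo [oLo NE]]] := odd_part NM0.
have Lo0 : (0 < Lo)%N by rewrite odd_gt0.
have MLo : (M %| Lo)%N.
  have : (M %| 2 ^ l * Lo)%N by rewrite -NE dvdn_mull.
  by rewrite Gauss_dvdr // coprime_sym coprimeXl // coprime2n.
have vL : [forall i, v i ^+ (2 ^ l * Lo) == 1].
  by apply/forallP => i; rewrite -NE exprM vN expr1n.
have ex_e : exists e, [forall i, v i ^+ (2 ^ e * Lo) == 1] by exists l.
case: (ex_minnP ex_e) => e /forallP veb emin.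
have ve i : v i ^+ (2 ^ e * Lo) = 1 by apply/eqP.
have rel : \sum_i ev (A i) z * v i = 0.
  by transitivity (\sum_i a i * w i) => //; apply: eq_bigr => i _; rewrite aE /v; ring.
have zx x : (m <= x)%N -> z ^+ (2 ^ x * Lo) = 1.
  move=> mx; have /dvdnP[q ->] : (2 ^ m * M %| 2 ^ x * Lo)%N.
    by rewrite dvdn_mul // dvdn_exp2l.
  by rewrite [(q * _)%N]mulnC exprM (prim_expr_order zP) expr1n.
have vx x i : (e <= x)%N -> v i ^+ (2 ^ x * Lo) = 1.
  move=> ex; have /dvdnP[q ->] : (2 ^ e * Lo %| 2 ^ x * Lo)%N.
    by rewrite dvdn_mul // dvdn_exp2l.
  by rewrite [(q * _)%N]mulnC exprM ve expr1n.
pose L := (2 ^ maxn m e * Lo)%N.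
have L0 : (0 < L)%N by rewrite muln_gt0 expn_gt0.
have zL : z ^+ L = 1 by apply: zx; apply: leq_maxl.
have vL' i : v i ^+ L = 1 by apply: vx; apply: leq_maxr.
have cop k : odd k -> coprime k Lo -> coprime k L.
  by move=> ok kL; rewrite coprimeMr kL andbT coprimeXr // coprimen2.
have copx x : (1 < x)%N -> coprime (1 + Lo * 2 ^ x.-1) L.
  case: x => [|[|x]] // _; apply: cop; first by rewrite oddD oddM oddX /= andbF.
  by rewrite /coprime gcdnC [(Lo * _)%N]mulnC addnC gcdnMDl gcdn1.
(* For [x] positive and at least [e] this power of [v i] squares to 1; [s] records where it is
   -1. *)
pose s x i := v i ^+ (2 ^ x.-1 * Lo) != 1.
have sE x i : (0 < x)%N -> (e <= x)%N -> v i ^+ (2 ^ x.-1 * Lo) = (-1) ^+ s x i.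
  move=> x0 ex; apply: sign_of_sqr1.
  by rewrite -exprM mulnC mulnA -expnS prednK // vx.
have s0 x : s x ord0 = false by rewrite /s v0 expr1n eqxx.
(* [2 ^ e] is the 2-part of the order of the torsion point.  Conjugating by
   [2 ^ K + Lo] or by [1 + Lo * 2 ^ (maxn m e).-1] acts on [v] up to the signs
   [s] as the [2 ^ K]-th power map, respectively as the identity. *)
case: (leqP (maxn m e) 1) => [|mu2].
  rewrite geq_max => /andP[m1 e1]; rewrite m1.
  exists (s 1%N) => //; right.
  have cK : coprime (2 ^ K + Lo) L.
    apply: cop; first by rewrite oddD oddX oLo gtn_eqF.
    by rewrite /coprime gcdnC gcdnDr gcdnC -/(coprime _ _) coprimeXl // coprime2n.
  have := conj_relation L0 cK zL vL' rel.
  (* The coefficients [cc] may not depend on the solution, whereas [Lo] does. Here [z ^+ M] is a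
     sign and [Lo] is an odd multiple of [M], so [Lo] can be replaced by [M]. *)
  rewrite (_ : z ^+ (2 ^ K + Lo) = z ^+ (2 ^ K + M)); last first.
    rewrite !exprD; congr (_ * _).
    have : (z ^+ M) ^+ 2 = 1.
      rewrite -exprM mulnC -[X in (X * _)%N](expn1 2); apply/eqP; rewrite -(prim_order_dvd zP).
      by rewrite dvdn_mul // dvdn_exp2l.
    move/sign_of_sqr1 => zM; case/dvdnP: MLo oLo => q ->; rewrite oddM => /andP[oq _].
    by rewrite mulnC exprM zM -exprM [(_ * q)%N]mulnC exprM -[(-1) ^+ q]signr_odd oq.
  move=> R; apply: etrans R; apply: eq_bigr => i _; rewrite /cc [v i ^+ _]exprD.
  have := sE 1%N i isT e1; rewrite expn0 mul1n => ->.
  by rewrite /v exprMn; ring.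
have R := conj_relation L0 (copx _ mu2) zL vL' rel.
have R' : \sum_i ev (A i) (z ^+ (1 + Lo * 2 ^ (maxn m e).-1)) * ((-1) ^+ s (maxn m e) i * v i) = 0.
  apply: etrans R; apply: eq_bigr => i _; congr (_ * _).
  by rewrite -sE ?leq_maxr 1?ltnW // exprD expr1 mulrC [in RHS]mulnC.
exists (s (maxn m e)) => //.
case: (leqP e m) => em.
  right; have mm : maxn m e = m by apply/maxn_idPl.
  rewrite mm in mu2 R' *; rewrite leqNgt mu2 /=.
  have zm : z ^+ (Lo * 2 ^ m.-1) = -1.
    have m0 : (0 < m)%N by apply: ltnW.
    have : (z ^+ (Lo * 2 ^ m.-1)) ^+ 2 = 1.
      by rewrite -exprM -mulnA -expnSr prednK // mulnC zx.
    move/sign_of_sqr1 => ->; case: eqP => // /eqP.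
    rewrite -(prim_order_dvd zP) -[in X in (X %| _)%N](prednK m0) expnS mulnAC.
    rewrite dvdn_pmul2r ?expn_gt0 // => /(dvdn_trans (dvdn_mulr _ (dvdnn _))).
    by rewrite dvdn2 oLo.
  apply: etrans R'; apply: eq_bigr => i _.
  by rewrite /cb exprD expr1 zm mulrN1 expr1 /v; ring.
(* Now [z] is fixed, and minimality of [e] forces at least one sign to be -1. *)
left; have mm : maxn m e = e by apply/maxn_idPr/ltnW.
rewrite mm in mu2 R' *.
have e0 : (0 < e)%N by apply: leq_ltn_trans em.
have zm : z ^+ (1 + Lo * 2 ^ e.-1) = z.
  by rewrite exprD expr1 mulnC zx ?mulr1 // -ltnS prednK.
split.
  apply/existsP/contraT; rewrite negb_exists => /forallP sF.
  have : (e <= e.-1)%N by apply: emin; apply/forallP => i; move: (sF i); rewrite negbK.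
  by rewrite -ltnS prednK // ltnn.
rewrite zm in R'; apply: etrans R'; apply: eq_bigr => i _.
by rewrite aE /v; ring.
Qed.

(** Both relations are homogeneous in [w], of degree 1 and [kappa], so the solution can be divided
    by [w ord0]. Coefficients that are not all cyclotomic are handled by one component, with no
    signs. *)
Lemma torsion_cover n (a : 'I_n.+1 -> C) K : a ord0 = 1 -> (0 < K)%N ->
  exists (kappa : nat) (c : ('I_n.+1 -> bool) -> 'I_n.+1 -> C),
  [/\ (kappa = 1%N /\ forall (s : 'I_n.+1 -> bool) l, s ord0 = false ->
          ~ (c s =1 fun i => l * a i)) \/
      (kappa = (2 ^ K)%N /\ forall s : 'I_n.+1 -> bool, s ord0 = false -> c s ord0 != 0)
    & forall w, (forall i, is_unity (w i)) -> \sum_i a i * w i = 0 ->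
      exists2 s : 'I_n.+1 -> bool, s ord0 = false &
        ((exists i, s i) /\ \sum_i (-1) ^+ s i * a i * w i = 0) \/
        \sum_i c s i * w i ^+ kappa = 0].
Proof.
move=> a0 K0; have [[b bna bP]|ac] := cyclotomic_component a0.
  exists 1%N, (fun=> b); split; first by left; split=> // s l _; apply: bna.
  by move=> w wu /(bP w wu) bw; exists (fun=> false) => //; right.
have [m0 /twisted_rep_minimal[m am minm]] := twisted_rep_exists a0 ac.
have [kappa [c [cP cov]]] := torsion_cover_twisted a0 K0 am minm.
exists kappa, c; split=> // w wu aw.
have w0 := is_unity_neq0 (wu ord0).
have [||| s s0 sP] := cov (fun i => w i / w ord0).
- by move=> i; apply/is_unityM/is_unityV.
- by rewrite mulfV.
- by under eq_bigr do rewrite mulrA; rewrite -mulr_suml aw mul0r.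
exists s => //; case: sP => [[sn0 E]|E]; [left; split=> // | right].
  by apply: (mulIf (invr_neq0 w0)); rewrite mul0r mulr_suml -[RHS]E; apply: eq_bigr => i _; rewrite mulrA.
have wk0 : (w ord0)^-1 ^+ kappa != 0 by rewrite expf_neq0 // invr_neq0.
apply: (mulIf wk0); rewrite mul0r mulr_suml -[RHS]E; apply: eq_bigr => i _.
by rewrite exprMn mulrA.
Qed.
End TorsionCover.

(** * Linear independence of large powers *)

Section Wronskian.
Variable C : numFieldType.
Implicit Types p q : {poly C}.

Lemma deriv_eq0_size p : p^`() = 0 -> (size p <= 1)%N.
Proof.
move=> dp; rewrite leqNgt; apply/negP => sp.
have := congr1 (fun q => q`_(size p).-2) dp.
rewrite coef_deriv coef0 => /eqP; rewrite -mulr_natr mulf_eq0 pnatr_eq0 orbF.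
have -> : (size p).-2.+1 = (size p).-1 by rewrite prednK // -ltnS prednK // ltnW.
by rewrite -lead_coefE lead_coef_eq0 => /eqP p0; rewrite p0 size_poly0 in sp.
Qed.

Lemma dvdp_deriv_const p : p != 0 -> p %| p^`() -> (size p = 1)%N.
Proof.
move=> p0 pd; apply/eqP; rewrite eqn_leq lt0n size_poly_eq0 p0 andbT.
apply: deriv_eq0_size; apply/eqP/contraT => /dvdp_leq/(_ pd).
by rewrite leqNgt lt_size_deriv.
Qed.

Lemma coprime_parts p q : p != 0 -> q != 0 ->
  exists g p1 q1, [/\ p = g * p1, q = g * q1, coprimep p1 q1, g != 0 & p1 != 0 /\ q1 != 0].
Proof.
move=> p0 q0; exists (gcdp p q), (p %/ gcdp p q), (q %/ gcdp p q).
have pE : p = gcdp p q * (p %/ gcdp p q) by rewrite mulrC divpK // dvdp_gcdl.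
have qE : q = gcdp p q * (q %/ gcdp p q) by rewrite mulrC divpK // dvdp_gcdr.
have g0 : gcdp p q != 0 by rewrite gcdp_eq0 negb_and p0.
split=> //; first by apply: coprimep_div_gcd; rewrite p0.
split; first by apply: contra p0 => /eqP e; rewrite pE e mulr0.
by apply: contra q0 => /eqP e; rewrite qE e mulr0.
Qed.

Lemma proportional_const g p1 q1 : size p1 = 1%N -> size q1 = 1%N ->
  exists c : C, g * q1 = c *: (g * p1).
Proof.
move=> /eqP/size_poly1P[a a0 ->] /eqP/size_poly1P[b b0 ->].
exists (b / a); rewrite ![g * _]mulrC !mul_polyC scalerA.
by rewrite -mulrA mulVf ?mulr1.
Qed.

(** Once the gcd is removed, each cofactor divides its own derivative and is therefore constant. *)
Lemma deriv_proportional p q : p != 0 -> p * q^`() = p^`() * q ->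
  exists c, q = c *: p.
Proof.
move=> p0 E; have [->|q0] := eqVneq q 0; first by exists 0; rewrite scale0r.
have [g [p1 [q1 [pE qE cop g0 [p10 q10]]]]] := coprime_parts p0 q0.
have E1 : p1 * q1^`() = p1^`() * q1.
  apply: (mulfI (mulf_neq0 g0 g0)); move/eqP: E; rewrite pE qE !derivM -subr_eq0 => /eqP E.
  by apply/eqP; rewrite -subr_eq0 -[X in _ == X]E; apply/eqP; ring.
rewrite pE qE; apply: proportional_const; apply: dvdp_deriv_const => //.
  by rewrite -(Gauss_dvdpl _ cop) -E1 dvdp_mulr.
by rewrite coprimep_sym in cop; rewrite -(Gauss_dvdpr _ cop) E1 dvdp_mull.
Qed.

(** After removal of the gcd, [p1 ^+ m] divides [B] and [q1 ^+ m] divides [A]; as [A] and [B] have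
    degree below [m], [p1] and [q1] are constants. *)
Lemma pow_proportional p q (A B : {poly C}) m : p != 0 -> q != 0 -> A != 0 -> B != 0 ->
  (size A <= m)%N -> (size B <= m)%N -> p ^+ m * A = q ^+ m * B ->
  exists c, q = c *: p.
Proof.
move=> p0 q0 A0 B0 sA sB E.
have [g [p1 [q1 [pE qE cop g0 [p10 q10]]]]] := coprime_parts p0 q0.
have E1 : p1 ^+ m * A = q1 ^+ m * B.
  apply: (mulfI (expf_neq0 m g0)); move: E; rewrite pE qE !exprMn => E.
  by rewrite !mulrA.
have m0 : (0 < m)%N by apply: leq_trans sA; rewrite lt0n size_poly_eq0.
have const (f h : {poly C}) : f != 0 -> h != 0 -> f ^+ m %| h -> (size h <= m)%N -> size f = 1%N.
  move=> f0 h0 fh sh; have := leq_trans (dvdp_leq h0 fh) sh.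
  have := size_exp f m.
  have : (0 < size (f ^+ m))%N by rewrite lt0n size_poly_eq0 expf_neq0.
  have : (0 < size f)%N by rewrite lt0n size_poly_eq0.
  by case: (size f) => [|[|k]] //=; case: (size _) => //= u _ _ ->; rewrite mulSn; clear; lia.
have cm : coprimep (p1 ^+ m) (q1 ^+ m) by rewrite coprimep_expl // coprimep_expr.
rewrite pE qE; apply: proportional_const.
  apply: (const _ B) => //; rewrite -(Gauss_dvdpr _ cm) -E1 dvdp_mulr //.
apply: (const _ A) => //; rewrite coprimep_sym in cm.
by rewrite -(Gauss_dvdpr _ cm) E1 dvdp_mulr.
Qed.

(** A degenerate Wronskian matrix forces linear dependence over the constants. Differentiating the
    relations shows that the derivatives of [g] satisfy all but the last of them, and elimination of
    the index [j] reduces [n]. *)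
Lemma wronskian_dep n (Y g : 'I_n -> {poly C}) :
    (forall k, (k < n)%N -> \sum_i g i * (Y i)^`(k) = 0) -> (exists i, g i != 0) ->
  exists2 c : 'I_n -> C, exists i, c i != 0 & \sum_i c i *: Y i = 0.
Proof.
elim: n Y g => [|n IH] Y g H [j gj]; first by case: j {gj}.
(* [h k] is the square of [g j] times the derivative of the quotient by [g j]; if all [h k] vanish,
   [g] is a multiple of a constant vector. *)
pose h k := g j * (g (lift j k))^`() - (g j)^`() * g (lift j k).
have H' k : (k < n)%N -> \sum_i (g i)^`() * (Y i)^`(k) = 0.
  move=> kn; have := congr1 (fun p => p^`()) (H k (ltnW kn)).
  rewrite linear_sum derivC /=; under eq_bigr do rewrite derivM -derivnS.
  by rewrite big_split /= (H k.+1 kn) addr0.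
have [[k hk]|h0] := altP (@existsP _ (fun k => h k != 0)).
  have [||c [i ci] cE] := IH (fun k => Y (lift j k)) h.
  - move=> d dn; have E1 := H d (ltnW dn); have E2 := H' d dn.
    rewrite (bigD1_ord j) //= in E1; rewrite (bigD1_ord j) //= in E2.
    have -> : \sum_i h i * (Y (lift j i))^`(d) =
       g j * (\sum_(i < n) (g (lift j i))^`() * (Y (lift j i))^`(d))
       - (g j)^`() * (\sum_(i < n) g (lift j i) * (Y (lift j i))^`(d)).
      by rewrite !mulr_sumr -sumrB; apply: eq_bigr => i _; rewrite /h; ring.
    move/eqP: E1; rewrite addrC addr_eq0 => /eqP->.
    by move/eqP: E2; rewrite addrC addr_eq0 => /eqP->; ring.
  - by exists k.
  exists (fun i => if unlift j i is Some k then c k else 0).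
    by exists (lift j i); rewrite liftK.
  rewrite (bigD1_ord j) //= unlift_none scale0r add0r -[RHS]cE.
  by apply: eq_bigr => k' _; rewrite liftK.
have /fin_all_exists[c cP] : forall i, exists c, g i = c *: g j.
  move=> i; have [k ->|->] := unliftP j i; last by exists 1; rewrite scale1r.
  apply: deriv_proportional => //; apply/eqP; rewrite -subr_eq0.
  by move: h0; rewrite negb_exists => /forallP/(_ k); rewrite negbK.
exists c.
  by exists j; apply/eqP => cj; move: (cP j) gj; rewrite cj scale0r => ->; rewrite eqxx.
apply: (mulfI gj); rewrite mulr0 mulr_sumr -[RHS](H 0%N isT).
by apply: eq_bigr => i _; rewrite derivn0 [in RHS]cP -scalerAr scalerAl.
Qed.

(** Each term takes one entry per row, and 0 + 1 + ... + (n - 1) = C(n, 2). *)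
Lemma size_det_rows n d (M : 'M[{poly C}]_n) :
    (forall (k i : 'I_n), (size (M k i) <= k * d + 1)%N) ->
  (size (\det M) <= 'C(n, 2) * d + 1)%N.
Proof.
move=> sM; rewrite /determinant; apply: (leq_trans (size_sum _ _ _)).
apply/bigmax_leqP => s _.
have -> : (-1) ^+ s * \prod_i M i (s i) =
   ((-1) ^+ s)%:P * \prod_i M i (s i) by rewrite rmorphXn rmorphN1.
rewrite mul_polyC; apply: (leq_trans (size_scale_leq _ _)).
apply: (leq_trans (size_prod_leq _ _)); rewrite card_ord.
have : (\sum_(i < n) size (M i (s i)) <= \sum_(i < n) (i * d + 1))%N.
  by apply: leq_sum => i _; apply: sM.
rewrite big_split /= -big_distrl /= sum_nat_const card_ord muln1 -(big_mkord xpredT id) -bin2_sum /=.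
by set X := bigop.body _ _ _; set Z := (_ * d)%N; clearbody X Z; lia.
Qed.


(* The numerators [twderiv k] satisfy [R ^ k * Y^(k) = Y * twderiv k] when
   [R * Y' = Y * L]: all derivatives of a product of powers of the factors of
   [R] keep the large powers. *)
Fixpoint twderiv (R L : {poly C}) k : {poly C} :=
  if k is k'.+1 then
    L * twderiv R L k' + R * (twderiv R L k')^`() - R^`() * twderiv R L k' *+ k'
  else 1.

Lemma twderivP R L (Y : {poly C}) k : R * Y^`() = Y * L ->
  R ^+ k * Y^`(k) = Y * twderiv R L k.
Proof.
move=> E; elim: k => [|k IH]; first by rewrite derivn0 mul1r mulr1.
have /(congr1 (fun p => R * p)) := congr1 (fun p => p^`()) IH.
rewrite !derivM deriv_exp -derivnS => D.
have -> : R ^+ k.+1 * Y^`(k.+1) =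
    R * (R^`() * R ^+ k.-1 *+ k * Y^`(k) + R ^+ k * Y^`(k.+1))
    - R^`() * (R ^+ k * Y^`(k)) *+ k.
  move: (Y^`(k)) (Y^`(k.+1)) (R^`()) => u v R'; clear.
  case: k => [|k']; rewrite /= ?mulr0n ?expr0 ?expr1; first by ring.
  by rewrite !exprS; ring.
rewrite D IH /=.
rewrite mulrDr [R * (Y^`() * _)]mulrA E.
by move: (twderiv R L k)^`() (R^`()) (twderiv R L k) => T' R' T; clear; ring.
Qed.

Lemma size_twderiv (R L : {poly C}) d k : (size R <= d.+2)%N -> (size L <= d.+1)%N ->
  (size (twderiv R L k) <= k * d + 1)%N.
Proof.
move=> sR sL; elim: k => [|k IH]; first by rewrite size_poly1.
have sd (p : {poly C}) n : (size p <= n.+1)%N -> (size p^`() <= n)%N.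
  move=> sp; have [->|p0] := eqVneq p 0; first by rewrite derivC size_poly0.
  by rewrite -ltnS; apply: leq_trans sp; apply: lt_size_deriv.
have sM (p q : {poly C}) a b c : (size p <= a)%N -> (size q <= b)%N -> (a + b <= c.+1)%N ->
    (size (p * q)%R <= c)%N.
  move=> pa qb abc; apply: (leq_trans (size_polyMleq p q)).
  by rewrite -subn1 leq_subLR add1n; apply: leq_trans (leq_add pa qb) abc.
have IHd : (size (twderiv R L k)^`() <= k * d)%N by apply: sd; rewrite -addn1.
have [T0|T0] := eqVneq (twderiv R L k)^`() 0.
  rewrite /= T0 mulr0 addr0; apply: (leq_trans (size_polyD _ _)).
  rewrite geq_max (sM _ _ _ _ _ sL IH) /=; last by rewrite mulSn; clear; lia.
  rewrite size_polyN -mulr_natr -polyC_natr mulrC mul_polyC.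
  apply: (leq_trans (size_scale_leq _ _)).
  by apply: (sM _ _ _ _ _ (sd _ _ sR) IH); rewrite mulSn; clear; lia.
rewrite /=; apply: (leq_trans (size_polyD _ _)); rewrite geq_max; apply/andP; split.
  apply: (leq_trans (size_polyD _ _)); rewrite geq_max (sM _ _ _ _ _ sL IH) /=; last by rewrite mulSn; clear; lia.
  by apply: (sM _ _ _ _ _ sR IHd); rewrite mulSn; clear; lia.
rewrite size_polyN -mulr_natr -polyC_natr mulrC mul_polyC.
apply: (leq_trans (size_scale_leq _ _)).
by apply: (sM _ _ _ _ _ (sd _ _ sR) IH); rewrite mulSn; clear; lia.
Qed.

(* Cramer's rule applied to the differentiated relation [Y0 + \sum_i Y i = 0]. *)
Lemma cramer_relation n d (R L0 : {poly C}) (Y0 : {poly C}) (Y L : 'I_n -> {poly C}) (j : 'I_n) :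
    R != 0 -> (size R <= d.+2)%N -> R * Y0^`() = Y0 * L0 -> (size L0 <= d.+1)%N ->
    (forall i, R * (Y i)^`() = Y i * L i) -> (forall i, (size (L i) <= d.+1)%N) ->
    (forall i, Y i != 0) -> Y0 + \sum_i Y i = 0 ->
    (forall c : 'I_n -> C, \sum_i c i *: Y i = 0 -> forall i, c i = 0) ->
  exists A B : {poly C}, [/\ Y j * A = Y0 * B, A != 0,
    (size A <= 'C(n, 2) * d + 1)%N & (size B <= 'C(n, 2) * d + 1)%N].
Proof.
move=> R0 sR E0 sL0 E sL Y_neq0 rel indep.
(* [N] is the Wronskian matrix with row [k] multiplied by [R ^+ k] and column [i] divided by [Y i],
   so its degrees no longer involve those of the [Y i]. *)
pose N : 'M[{poly C}]_n := \matrix_(k, i) twderiv R (L i) k.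
pose N' : 'M[{poly C}]_n :=
  \matrix_(k, i) if i == j then twderiv R L0 k else twderiv R (L i) k.
pose y : 'cV[{poly C}]_n := \col_i Y i.
pose b : 'cV[{poly C}]_n := \col_k twderiv R L0 k.
have Ny : N *m y = - (Y0 *: b).
  apply/colP => k; rewrite !mxE; apply/eqP; rewrite -addr_eq0 addrC; apply/eqP.
  have : R ^+ k * (Y0 + \sum_i Y i)^`(k) = 0 by rewrite rel linear0 mulr0.
  rewrite derivnD linear_sum /= mulrDr (twderivP _ E0) mulr_sumr => S0; apply: etrans S0; congr (_ + _).
  by apply: eq_bigr => i _; rewrite !mxE (twderivP _ (E i)) mulrC.
(* A kernel vector of [N], multiplied by the products of the other [Y k], becomes one of the
   Wronskian matrix itself. *)
have detN : \det N != 0.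
  apply/negP; rewrite -det_tr => /det0P[v v0 vN].
  pose P := \prod_i Y i.
  pose g i := v 0 i * \prod_(k | k != i) Y k.
  have [k kn||c [i ci] /indep c0] := @wronskian_dep n Y g; last by rewrite c0 eqxx in ci.
    apply: (mulfI (expf_neq0 k R0)); rewrite mulr0 mulr_sumr.
    have := congr1 (fun M : 'rV[{poly C}]_n => P * M 0 (Ordinal kn)) vN.
    rewrite !mxE mulr0 mulr_sumr => S0; apply: etrans S0; apply: eq_bigr => i _.
    rewrite !mxE /= mulrCA (twderivP _ (E i)) /g /P [\prod_i _](bigD1 i) //=.
    by move: (v 0 i) (Y i) (twderiv _ _ _) (bigop.body _ _ _) => ? ? ? ?; ring.
  have [i vi] : exists i, v 0 i != 0.
    apply/existsP/contraT; rewrite negb_exists => /forallP v0'.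
    by case/negP: v0; apply/eqP/rowP => i; rewrite mxE; apply/eqP; move: (v0' i); rewrite negbK.
  by exists i; rewrite mulf_neq0 //; apply/prodf_neq0 => k _.
have cof : (\adj N *m b) j 0 = \det N'.
  rewrite (expand_det_col _ j) mxE; apply: eq_bigr => k _.
  rewrite !mxE eqxx mulrC; congr (_ * _); rewrite /cofactor; congr (_ * \det _).
  by apply/matrixP => p q; rewrite !mxE eq_sym (negPf (neq_lift _ _)).
exists (\det N), (- \det N'); split=> //; last first.
- rewrite size_polyN; apply: size_det_rows => k i; rewrite mxE.
  by case: ifP => _; apply: size_twderiv.
- by apply: size_det_rows => k i; rewrite mxE; apply: size_twderiv.
have := congr1 (fun M : 'cV[{poly C}]_n => (\adj N *m M) j 0) Ny.
rewrite mulmxA mul_adj_mx mul_scalar_mx mulmxN -scalemxAr !mxE /= -cof mulrN mulrC mxE => ->.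
by [].
Qed.

(** In a shortest relation all coefficients are nonzero, and Cramer's rule equates two m-th powers
    up to cofactors of degree at most C(t - 1, 2) d. This bound is free of [m], so for larger [m]
    two of the [y i] would be proportional. *)
Theorem powers_independent t d m (R : {poly C}) (y L : 'I_t -> {poly C}) :
    R != 0 -> (size R <= d.+2)%N -> (forall i, y i != 0) ->
    (forall i, R * (y i)^`() = y i * L i) -> (forall i, (size (L i) <= d.+1)%N) ->
    (forall i j c, i != j -> y j <> c *: y i) ->
    ('C(t.-1, 2) * d < m)%N ->
  forall c : 'I_t -> C, \sum_i c i *: y i ^+ m = 0 -> forall i, c i = 0.
Proof.
move=> R0 sR; elim: t y L => [|t IH] y L y0 E sL prop bnd c rel; first by case.
have sub (j : 'I_t.+1) (c' : 'I_t -> C) : \sum_i c' i *: y (lift j i) ^+ m = 0 -> forall i, c' i = 0.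
  apply: (IH (fun i => y (lift j i)) (fun i => L (lift j i))) => //.
    by move=> i k a ik; apply: prop; rewrite (inj_eq lift_inj).
  apply: leq_ltn_trans bnd; rewrite leq_mul2r; apply/orP; right.
  by case: (t) => //= t'; apply: leq_bin2l.
have [[j cj]|] := altP (@existsP _ (fun j => c j == 0)).
  move/eqP: cj => cj i; rewrite (bigD1_ord j) //= cj scale0r add0r in rel.
  by have [k ->|->//] := unliftP j i; apply: (sub j (fun i => c (lift j i))).
rewrite negb_exists => /forallP cn0.
case: t => [|t] in y L y0 E sL prop bnd c rel IH sub cn0 *.
  move: rel; rewrite big_ord1 => /eqP; rewrite scaler_eq0 (negPf (cn0 _)) /=.
  by rewrite expf_eq0 (negPf (y0 _)) andbF.
have Em i a : R * (a *: y i ^+ m)^`() = (a *: y i ^+ m) * (L i *+ m).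
  rewrite derivZ deriv_exp -scalerAr -scalerAl; congr (_ *: _).
  case: (m) => [|m']; first by rewrite !mulr0n !mulr0.
  rewrite /= !mulrnAr mulrA E exprS; congr (_ *+ _).
  by rewrite -!mulrA [L i * _]mulrC.
have sLm i : (size (L i *+ m) <= d.+1)%N.
  rewrite -mulr_natr -polyC_natr mulrC mul_polyC.
  exact: leq_trans (size_scale_leq _ _) (sL i).
have [|||A [B [AB A0 sA sB]]] := @cramer_relation t.+1 d R (L ord0 *+ m)
   (c ord0 *: y ord0 ^+ m) (fun i => c (lift ord0 i) *: y (lift ord0 i) ^+ m)
   (fun i => L (lift ord0 i) *+ m) ord0 R0 sR (Em _ _) (sLm _) (fun _ => Em _ _) (fun _ => sLm _).
- by move=> i; rewrite scaler_eq0 negb_or cn0 expf_neq0.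
- by apply: etrans rel; rewrite [RHS](bigD1_ord ord0).
- move=> c' E' i; have := sub ord0 (fun i => c' i * c (lift ord0 i)).
  have -> : \sum_i (c' i * c (lift ord0 i)) *: y (lift ord0 i) ^+ m = 0.
    by apply: etrans E'; apply: eq_bigr => k _; rewrite scalerA.
  by move=> /(_ erefl i)/eqP; rewrite mulf_eq0 (negPf (cn0 _)) orbF => /eqP.
have bm : (('C(t.+1, 2) * d) + 1 <= m)%N by rewrite addn1.
have c1n := cn0 (lift ord0 ord0).
have B0 : B != 0.
  apply: contra_eq_neq AB => ->; rewrite mulr0 mulf_neq0 // scaler_eq0 negb_or c1n.
  by rewrite expf_neq0.
have [c0 yE] : exists c0, y ord0 = c0 *: y (lift ord0 ord0).
  apply: (@pow_proportional _ _ (c (lift ord0 ord0) *: A) (c ord0 *: B) m) => //.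
  - by rewrite scaler_eq0 negb_or c1n.
  - by rewrite scaler_eq0 negb_or cn0.
  - by rewrite size_scale //; apply: leq_trans sA bm.
  - by rewrite size_scale //; apply: leq_trans sB bm.
  by rewrite -!scalerAr !scalerAl.
by case: (prop (lift ord0 ord0) ord0 c0 isT yE).
Qed.
End Wronskian.

(** * Perron's theorem *)

Section PolynomialFamilies.
Variable C : numFieldType.

Definition polyfun (f : C -> C) := exists p : {poly C}, forall u, f u = p.[u].

Lemma polyfun_cst c : polyfun (fun=> c).
Proof. by exists c%:P => u; rewrite hornerC. Qed.

Lemma polyfun_id : polyfun id.
Proof. by exists 'X => u; rewrite hornerX. Qed.

Lemma polyfunD f g : polyfun f -> polyfun g -> polyfun (fun u => f u + g u).
Proof. by move=> [p pE] [q qE]; exists (p + q) => u; rewrite hornerD pE qE. Qed.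

Lemma polyfunM f g : polyfun f -> polyfun g -> polyfun (fun u => f u * g u).
Proof. by move=> [p pE] [q qE]; exists (p * q) => u; rewrite hornerM pE qE. Qed.

Lemma polyfun_sum (I : Type) (r : seq I) P (F : I -> C -> C) :
  (forall i, polyfun (F i)) -> polyfun (fun u => \sum_(i <- r | P i) F i u).
Proof.
move=> H; elim: r => [|i r IH].
  by exists 0 => u; rewrite big_nil horner0.
have [p pE] := IH; have [q qE] := H i.
exists (if P i then q + p else p) => u; rewrite big_cons pE.
by case: (P i); rewrite ?hornerD ?qE.
Qed.

Lemma polyfun_prod (I : Type) (r : seq I) P (F : I -> C -> C) :
  (forall i, polyfun (F i)) -> polyfun (fun u => \prod_(i <- r | P i) F i u).
Proof.
move=> H; elim: r => [|i r IH].
  by exists 1 => u; rewrite big_nil hornerC.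
have [p pE] := IH; have [q qE] := H i.
exists (if P i then q * p else p) => u; rewrite big_cons pE.
by case: (P i); rewrite ?hornerM ?qE.
Qed.

Lemma polyfun_det n (M : C -> 'M[C]_n) :
  (forall i j, polyfun (fun u => M u i j)) -> polyfun (fun u => \det (M u)).
Proof.
move=> H; apply: polyfun_sum => s; apply: polyfunM; first exact: polyfun_cst.
by apply: polyfun_prod => i; apply: H.
Qed.

Definition mpolyfun n (f : C -> {mpoly C[n]}) := forall m, polyfun (fun u => (f u)@_m).

Lemma mpolyfun_cst n (p : {mpoly C[n]}) : mpolyfun (fun=> p).
Proof. by move=> m; apply: polyfun_cst. Qed.

Lemma mpolyfunD n (f g : C -> {mpoly C[n]}) :
  mpolyfun f -> mpolyfun g -> mpolyfun (fun u => f u + g u).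
Proof.
move=> hf hg m; have [p pE] := polyfunD (hf m) (hg m).
by exists p => u; rewrite mcoeffD pE.
Qed.

Lemma mpolyfunZ n (p : {mpoly C[n]}) : mpolyfun (fun u => u *: p).
Proof.
move=> m; have [q qE] := polyfunM polyfun_id (polyfun_cst p@_m).
by exists q => u; rewrite mcoeffZ -qE.
Qed.

Lemma mpolyfunM n (f g : C -> {mpoly C[n]}) :
  mpolyfun f -> mpolyfun g -> mpolyfun (fun u => f u * g u).
Proof.
move=> hf hg m.
have [p pE] : polyfun (fun u => \sum_(k : 'X_{1..n < (mdeg m).+1, (mdeg m).+1} |
     m == (k.1 + k.2)%MM) ((f u)@_k.1 * (g u)@_k.2)).
  by apply: polyfun_sum => k; apply: polyfunM.
by exists p => u; rewrite mcoeffM pE.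
Qed.

Lemma mpolyfunX n (f : C -> {mpoly C[n]}) k : mpolyfun f -> mpolyfun (fun u => f u ^+ k).
Proof.
move=> hf; elim: k => [|k IH]; first exact: mpolyfun_cst.
move=> m; have [p pE] := mpolyfunM hf IH m.
by exists p => u; rewrite exprS pE.
Qed.

Lemma mpolyfun_prod n (I : Type) (r : seq I) (F : I -> C -> {mpoly C[n]}) :
  (forall i, mpolyfun (F i)) -> mpolyfun (fun u => \prod_(i <- r) F i u).
Proof.
move=> H; elim: r => [|i r IH] m.
  by have [p pE] := mpolyfun_cst (1 : {mpoly C[n]}) m; exists p => u; rewrite big_nil; apply: pE.
have [p pE] := mpolyfunM (H i) IH m.
by exists p => u; rewrite big_cons pE.
Qed.

(** Fewer than [size q] of the listed integers are roots of [q], and fewer than [size g] have a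
    reciprocal that is a root of [g]. The reciprocal occurs because F + t X^D = t (X^D + t^-1 F). *)
Lemma generic_reciprocal (q g : {poly C}) : q != 0 -> g != 0 ->
  exists t, [/\ t != 0, q.[t] != 0 & g.[t^-1] != 0].
Proof.
move=> q0 g0; pose s := [seq k.+1%:R : C | k <- iota 0 (size q + size g)].
have us : uniq s.
  by rewrite map_inj_uniq ?iota_uniq // => a b /eqP; rewrite eqr_nat => /eqP[].
have s0 t : t \in s -> t != 0 by case/mapP => k _ ->; rewrite pnatr_eq0.
have c1 : (count (root q) s < size q)%N.
  by rewrite -size_filter max_poly_roots ?filter_uniq // filter_all.
have c2 : (count (fun t => root g t^-1) s < size g)%N.
  rewrite -size_filter -(size_map (fun t => t^-1)) max_poly_roots //.
    by rewrite all_map filter_all.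
  by rewrite map_inj_uniq ?filter_uniq //; apply: invr_inj.
have : has (fun t => ~~ root q t && ~~ root g t^-1) s.
  rewrite -[has _ _]negbK -all_predC; apply/negP => /allP H.
  have : count (predU (root q) (fun t => root g t^-1)) s = size s.
    apply/eqP; rewrite -all_count; apply/allP => t /H /=.
    by rewrite negb_and !negbK.
  have := count_predUI (root q) (fun t => root g t^-1) s.
  rewrite size_map size_iota => E1 E2; move: c1 c2 E1; rewrite E2.
  move: (count (predI _ _) _) (count _ _) (count _ _) (size q) (size g); clear => *; lia.
by case/hasP => t /s0 t0 /andP[tq tg]; exists t.
Qed.
End PolynomialFamilies.

Section Degree.
Variables (R : idomainType) (n : nat).
Implicit Types p q : {mpoly R[n]}.

Lemma msize_leP p d : reflect (forall m, m \in msupp p -> mdeg m <= d)%N (msize p <= d.+1)%N.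
Proof.
apply: (iffP idP) => [H m mp|H].
  by rewrite -ltnS; apply: leq_trans (msize_mdeg_lt mp) H.
by rewrite msizeE; apply/bigmax_leqP_seq => m mp _; apply: H.
Qed.

Lemma msizeM_leS p q a b :
  (msize p <= a.+1 -> msize q <= b.+1 -> msize (p * q)%R <= (a + b).+1)%N.
Proof.
move=> /msize_leP pa /msize_leP qb; apply/msize_leP => m /msuppM_le.
by case/allpairsP => -[m1 m2] /= [m1p m2q ->]; rewrite mdegD leq_add ?pa ?qb.
Qed.

Lemma msizeX_leS p a k : (msize p <= a.+1 -> msize (p ^+ k) <= (a * k).+1)%N.
Proof.
move=> pa; elim: k => [|k IH]; first by rewrite expr0 muln0 msize1.
by rewrite exprS mulnS; apply: msizeM_leS.
Qed.

Lemma msize_prod_leS (I : Type) (r : seq I) (F : I -> {mpoly R[n]}) (a : I -> nat) :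
  (forall i, msize (F i) <= (a i).+1)%N ->
  (msize (\prod_(i <- r) F i)%R <= (\sum_(i <- r) a i).+1)%N.
Proof.
move=> H; elim: r => [|i r IH]; first by rewrite !big_nil msize1.
by rewrite !big_cons; apply: msizeM_leS.
Qed.

Lemma msizeD_leS p q a :
  (msize p <= a.+1 -> msize q <= a.+1 -> msize (p + q)%R <= a.+1)%N.
Proof. by move=> pa qa; apply: leq_trans (msizeD_le _ _) _; rewrite geq_max pa. Qed.

End Degree.

(** * Decomposition over the algebra generated by a perturbed family *)

Section Perron.
Variables (C : numFieldType) (l D' : nat).
Local Notation D := D'.+1.
Local Notation msub h := (mmap (@mpolyC l C) h).

Definition perturb (F : 'I_l -> {mpoly C[l]}) u i : {mpoly C[l]} := 'X_i ^+ D + u *: F i.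

(** The monomial of exponent [e] with each full power ['X_i ^+ D] replaced by [G i]. *)
Definition mixed_basis (G : 'I_l -> {mpoly C[l]}) (e : 'X_{1..l}) : {mpoly C[l]} :=
  \prod_i (G i ^+ (e i %/ D) * 'X_i ^+ (e i %% D)).

Lemma msize_X i : (msize ('X_i : {mpoly C[l]}) <= 2)%N.
Proof. by rewrite msizeX mdeg1. Qed.

Lemma msize_perturb F u i : (msize (F i) <= D.+1)%N -> (msize (perturb F u i) <= D.+1)%N.
Proof.
move=> sF; apply: msizeD_leS; last by apply: leq_trans (msizeZ_le _ _) sF.
by rewrite -[X in (_ <= X.+1)%N]mul1n; apply: msizeX_leS; apply: msize_X.
Qed.

Lemma msize_mixed_basis G e : (forall i, msize (G i) <= D.+1)%N ->
  (msize (mixed_basis G e) <= (mdeg e).+1)%N.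
Proof.
move=> sG; rewrite mdegE; apply: msize_prod_leS => i.
rewrite {3}(divn_eq (e i) D); apply: msizeM_leS.
  by rewrite mulnC; apply: msizeX_leS.
by rewrite -[X in (_ <= X.+1)%N]mul1n; apply: msizeX_leS; apply: msize_X.
Qed.

Lemma mixed_basisX e : mixed_basis (fun i => 'X_i ^+ D) e = 'X_[e].
Proof.
rewrite mpolyXE_id; apply: eq_bigr => i _.
by rewrite -exprM mulnC -exprD -divn_eq.
Qed.

(* At [u = 0] the mixed basis consists of the monomials, so the determinant of
   the change of basis is a nonzero polynomial in [u]. *)
Lemma mixed_basis_span (F : 'I_l -> {mpoly C[l]}) a : (forall i, msize (F i) <= D.+1)%N ->
  exists2 g : {poly C}, g != 0 & forall u, g.[u] != 0 -> forall p, (msize p <= a.+1)%N ->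
    exists w : 'X_{1..l < a.+1} -> C, p = \sum_e w e *: mixed_basis (perturb F u) e.
Proof.
move=> sF.
pose N := #|{: 'X_{1..l < a.+1}}|.
pose M u : 'M[C]_N := \matrix_(i, j)
  (mixed_basis (perturb F u) (enum_val i : 'X_{1..l < a.+1}))@_(enum_val j : 'X_{1..l < a.+1}).
have [g gE] : polyfun (fun u => \det (M u)).
  apply: polyfun_det => i j.
  have H : mpolyfun (fun u => mixed_basis (perturb F u) (enum_val i : 'X_{1..l < a.+1})).
    apply: mpolyfun_prod => k; apply: mpolyfunM; last exact: mpolyfun_cst.
    by apply: mpolyfunX; apply: mpolyfunD; [apply: mpolyfun_cst | apply: mpolyfunZ].
  by have [p pE] := H (enum_val j : 'X_{1..l < a.+1}); exists p => u; rewrite mxE pE.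
exists g.
  suff M0 : M 0 = 1%:M.
    by apply/eqP => g0; have /eqP := gE 0; rewrite g0 horner0 M0 det1 oner_eq0.
  apply/matrixP => i j; rewrite !mxE.
  have -> : mixed_basis (perturb F 0) (enum_val i : 'X_{1..l < a.+1}) = 'X_[(enum_val i : 'X_{1..l < a.+1})].
    rewrite -mixed_basisX; apply: eq_bigr => k _; congr (_ ^+ _ * _).
    by rewrite /perturb scale0r addr0.
  by rewrite mcoeffX -bmeqP (inj_eq enum_val_inj).
move=> u gu p sp.
have Mu : M u \in unitmx by rewrite unitmxE unitfE gE.
pose v : 'rV[C]_N := \row_j p@_(enum_val j : 'X_{1..l < a.+1}).
pose w := v *m invmx (M u).
exists (fun e => w 0 (enum_rank e)).
have vE : v = w *m M u by rewrite mulmxKV.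
apply/mpolyP => m; rewrite raddf_sum /=.
have [ma|ma] := ltnP (mdeg m) a.+1; last first.
  rewrite memN_msupp_eq0 ?(msize_mdeg_ge (leq_trans sp ma)) // big1 // => e _.
  rewrite mcoeffZ memN_msupp_eq0 ?mulr0 //; apply: msize_mdeg_ge.
  apply: leq_trans (msize_mixed_basis _ (fun i => msize_perturb u (sF i))) _.
  by apply: leq_trans (bmdeg e) ma.
have := congr1 (fun A : 'rV[C]_N => A 0 (enum_rank (BMultinom ma))) vE.
rewrite !mxE enum_rankK /= => ->.
rewrite (reindex (@enum_val {: 'X_{1..l < a.+1}} xpredT)) /=; last by apply/onW_bij/enum_val_bij.
by apply: eq_bigr => j _; rewrite mcoeffZ enum_valK !mxE enum_rankK.
Qed.

Local Notation Box := {ffun 'I_l -> 'I_D}.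
Definition boxm (b : Box) : 'X_{1..l} := [multinom (b i : nat) | i < l].
Definition mquo (e : 'X_{1..l}) : 'X_{1..l} := [multinom (e i %/ D)%N | i < l].
Definition mrem (e : 'X_{1..l}) : Box := [ffun i => Ordinal (ltn_pmod (e i) (ltn0Sn D'))].

Lemma mdeg_quo_rem e : (D * mdeg (mquo e) + mdeg (boxm (mrem e)) = mdeg e)%N.
Proof.
rewrite !mdegE big_distrr -big_split; apply: eq_bigr => i _ /=.
by rewrite !mnmE ffunE /= mulnC -divn_eq.
Qed.

Lemma mdeg_mnmwiden (e : 'X_{1..l}) : mdeg (mnmwiden e) = mdeg e.
Proof.
rewrite !mdegE big_ord_recr /= mnmwiden_ordmax addn0.
by apply: eq_bigr => i _; rewrite mnmwiden_widen.
Qed.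

(** The mixed basis is regrouped by the remainders of the exponents modulo [D]. The coefficients
    live in [l + 1] variables but avoid the last one, reserved for [H] in [perturbed_relation]. *)
Lemma box_decomposition (F : 'I_l -> {mpoly C[l]}) a : (forall i, msize (F i) <= D.+1)%N ->
  exists2 g : {poly C}, g != 0 & forall u, g.[u] != 0 -> forall p, (msize p <= a.+1)%N ->
    exists m : Box -> {mpoly C[l.+1]},
      (forall H, p = \sum_b msub (fun i => if unlift ord_max i is Some j then perturb F u j else H) (m b)
          * 'X_[boxm b]) /\
      forall b mu, mu \in msupp (m b) -> mu ord_max = 0%N /\ (D * mdeg mu + mdeg (boxm b) <= a)%N.
Proof.
move=> sF; have [g g0 gP] := mixed_basis_span a sF; exists g => // u gu p sp.
have [w ->] := gP u gu p sp.
pose m b := \sum_(e : 'X_{1..l < a.+1} | mrem e == b) w e *: 'X_[C, mnmwiden (mquo e)].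
exists m; split.
  move=> H; rewrite (partition_big (fun e : 'X_{1..l < a.+1} => mrem e) xpredT) //=.
  apply: eq_bigr => b _; rewrite raddf_sum /= mulr_suml; apply: eq_bigr => e /eqP<-.
  rewrite mmapZ mmapX -mul_mpolyC -mulrA; congr (_ * _).
  rewrite /mixed_basis /mmap1 big_ord_recr /= mnmwiden_ordmax expr0 mulr1 big_split /=.
  congr (_ * _).
    apply: eq_bigr => i _; rewrite mnmwiden_widen mnmE.
    suff -> : widen_ord (leqnSn l) i = lift ord_max i by rewrite liftK.
    by apply/val_inj; rewrite /= /bump leqNgt ltn_ord.
  by rewrite mpolyXE_id; apply: eq_bigr => i _; rewrite mnmE ffunE.
move=> b mu /msupp_sum_le /flattenP[s /mapP[e]].
rewrite mem_filter => /andP[/eqP<- _] -> /msuppZ_le /mem_msuppXP <-.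
rewrite mnmwiden_ordmax mdeg_mnmwiden mdeg_quo_rem; split=> //.
by rewrite -ltnS bmdeg.
Qed.

End Perron.

Section Perron2.
Variables (C : numFieldType) (l D' : nat).
Local Notation D := D'.+1.
Local Notation msub h := (mmap (@mpolyC l C) h).
Local Notation Box := {ffun 'I_l -> 'I_D}.

Lemma msupp_prod_weight k (I : Type) (r : seq I) (F : I -> {mpoly C[k]}) (x y : I -> nat) d :
    (forall i mu, mu \in msupp (F i) -> d * mdeg mu + y i <= x i)%N ->
  forall mu, mu \in msupp (\prod_(i <- r) F i) ->
    (d * mdeg mu + \sum_(i <- r) y i <= \sum_(i <- r) x i)%N.
Proof.
move=> H; elim: r => [|i r IH] mu.
  by rewrite !big_nil msupp1 inE => /eqP->; rewrite mdeg0 muln0.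
rewrite !big_cons => /msuppM_le/allpairsP[[m1 m2] /= [m1p m2p ->]].
have := H i _ m1p; have := IH _ m2p; rewrite mdegD mulnDr.
by move: (bigop.body _ _ _) (bigop.body _ _ _) (d * _)%N (d * _)%N; clear; lia.
Qed.

(* Cayley-Hamilton for multiplication by [H] on the module of [box_decomposition]. *)
Lemma perturbed_relation (F : 'I_l -> {mpoly C[l]}) : (forall i, msize (F i) <= D.+1)%N ->
  exists2 g : {poly C}, g != 0 & forall u, g.[u] != 0 -> forall H, (msize H <= D.+1)%N ->
    exists P : {mpoly C[l.+1]}, [/\ P != 0, (msize P <= (D ^ l).+1)%N &
      msub (fun i => if unlift ord_max i is Some j then perturb D' F u j else H) P = 0].
Proof.
move=> sF.
have /fin_all_exists2[g g0 gP] := fun b : Box =>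
  box_decomposition (D + mdeg (boxm b)) sF.
exists (\prod_b g b); first by apply/prodf_neq0 => b _.
move=> u gu H sH.
have gbu b : (g b).[u] != 0.
  by apply: contra gu => /eqP gb; rewrite horner_prod (bigD1 b) //= gb mul0r.
have sHX (b : Box) : (msize (H * 'X_[boxm b])%R <= (D + mdeg (boxm b)).+1)%N.
  by apply: msizeM_leS => //; rewrite msizeX.
have /fin_all_exists[m mP] := fun b => gP b u (gbu b) _ (sHX b).
pose h i := if unlift ord_max i is Some j then perturb D' F u j else H.
pose n := #|{: Box}|.
pose eb (i : 'I_n) : Box := enum_val i.
pose N : 'M[{mpoly C[l.+1]}]_n :=
  \matrix_(i, j) ((i == j)%:R * 'X_ord_max - m (eb i) (eb j)).
exists (\det N); split.
(* Sending the first [l] variables to 0 turns [N] into the characteristic matrix of a constant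
   matrix, whose determinant is monic. *)
- pose phi := mmap (@polyC C) (fun i : 'I_l.+1 => if i == ord_max then 'X else 0).
  have phim i j : exists c, phi (m (eb i) (eb j)) = c%:P.
    have [_ /(_ (eb j)) mw] := mP (eb i).
    exists (\sum_(mu <- msupp (m (eb i) (eb j))) (m (eb i) (eb j))@_mu *
       \prod_(k < l.+1) 0 ^+ mu k).
    rewrite /phi /mmap rmorph_sum /= !big_seq; apply: eq_bigr => mu /mw[mu0 _].
    rewrite rmorphM rmorph_prod /=; congr (_ * _); apply: eq_bigr => k _.
    rewrite rmorphXn /=; case: eqP => // ->; by rewrite mu0 !expr0.
  have /fin_all_exists[K KP] := fun i => fin_all_exists (phim i).
  apply/eqP => detN0.
  have : phi (\det N) = 0 by rewrite detN0 /phi rmorph0.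
  rewrite /phi -det_map_mx (_ : map_mx _ N = char_poly_mx (\matrix_(i, j) K i j)).
    by apply/eqP; rewrite monic_neq0 // char_poly_monic.
  apply/matrixP => i j; rewrite [LHS]mxE [N i j]mxE !mxE.
  transitivity ((i == j)%:R * phi 'X_ord_max - phi (m (eb i) (eb j))).
    by rewrite /= rmorphB rmorphM rmorph_nat.
  by rewrite KP /phi mmapX mmap1U eqxx mulr_natl.
(* In each term of the determinant the box degrees cancel along the permutation, leaving [D] times
   the number of boxes, which is [D ^ l]. *)
- apply/msize_leP => mu /msupp_sum_le /flattenP[_ /mapP[s _ ->]].
  have -> : (-1) ^+ s * \prod_i N i (s i) =
      (((-1) ^+ s)%:MP : {mpoly C[l.+1]}) * \prod_i N i (s i).
    by rewrite rmorphXn rmorphN1.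
  rewrite mul_mpolyC => /msuppZ_le.
  move/(@msupp_prod_weight _ _ _ _ (fun i => D + mdeg (boxm (eb i)))%N
     (fun i => mdeg (boxm (eb (s i)))) D) => /(_ _) W.
  have {}W : (D * mdeg mu + \sum_i mdeg (boxm (eb (s i))) <=
     \sum_i (D + mdeg (boxm (eb i))))%N.
    apply: W => i nu; rewrite mxE => /msuppB_le; rewrite mem_cat => /orP[].
      case: eqP => [<-|_]; last by rewrite mul0r msupp0.
      by rewrite mul1r => /mem_msuppXP<-; rewrite mdeg1 muln1.
    by have [_ mw] := mP (eb i); case/mw.
  rewrite big_split /= sum_nat_const card_ord in W.
  rewrite -(reindex_inj (h := s) perm_inj (P := xpredT)
     (F := fun i => mdeg (boxm (eb i)))) leq_add2r mulnC leq_pmul2r // in W.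
  by apply: leq_trans W _; rewrite /n card_ffun !card_ord.
pose v : 'cV[{mpoly C[l]}]_n := \col_j 'X_[boxm (eb j)].
have Nv : map_mx (msub h) N *m v = 0.
  apply/colP => i; rewrite !mxE.
  have [/(_ H) mE _] := mP (eb i).
  transitivity (H * 'X_[boxm (eb i)] - H * 'X_[boxm (eb i)]); last exact: subrr.
  rewrite {2}mE (reindex (@enum_val {: Box} xpredT)) /=; last by apply/onW_bij/enum_val_bij.
  transitivity (\sum_(j < n) ((i == j)%:R * msub h 'X_ord_max * 'X_[boxm (eb j)]
      - msub h (m (eb i) (eb j)) * 'X_[boxm (eb j)])).
    by apply: eq_bigr => j _; rewrite !mxE /= rmorphB rmorphM rmorph_nat /= mulrBl.
  rewrite sumrB; congr (_ - _).
  rewrite (bigD1 i) //= eqxx mul1r mmapX mmap1U /h unlift_none big1 ?addr0 //.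
  by move=> j ji; rewrite eq_sym (negPf ji) !mul0r.
have := congr1 (mulmx (\adj (map_mx (msub h) N))) Nv.
rewrite mulmxA mul_adj_mx mulmx0 mul_scalar_mx det_map_mx => /colP.
(* The determinant annihilates every box monomial, in particular the constant 1. *)
pose b0 : Box := [ffun=> ord0].
move/(_ (enum_rank b0)); rewrite !mxE /eb enum_rankK.
have -> : boxm b0 = 0%MM by apply/mnmP => i; rewrite mnmE ffunE mnm0E.
by rewrite mpolyX0 mulr1.
Qed.

End Perron2.

Section Perron3.
Variables (C : numFieldType) (l D' : nat).
Local Notation D := D'.+1.
Local Notation msub h := (mmap (@mpolyC l C) h).

Lemma msize_mmap1 k (h : 'I_k -> {mpoly C[l]}) (e : 'X_{1..k}) a :
  (forall i, msize (h i) <= a.+1)%N -> (msize (mmap1 h e) <= (a * mdeg e).+1)%N.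
Proof.
move=> sh; rewrite mdegE big_distrr; apply: msize_prod_leS => i.
exact: msizeX_leS.
Qed.

Lemma msubE k (h : 'I_k -> {mpoly C[l]}) d (P : {mpoly C[k]}) : (msize P <= d.+1)%N ->
  msub h P = \sum_(e : 'X_{1..k < d.+1}) P@_e *: mmap1 h e.
Proof.
move=> sP; rewrite (mmapE _ sP); apply: eq_bigr => e _.
by rewrite mul_mpolyC.
Qed.

(* The families [F + t X^D] with [t != 0] generic satisfy a relation by
   [perturbed_relation], and linear independence at [t = 0] would persist for
   generic [t]. *)
Theorem perron (F : 'I_l.+1 -> {mpoly C[l]}) : (forall i, msize (F i) <= D.+1)%N ->
  exists P : {mpoly C[l.+1]}, [/\ P != 0, (msize P <= (D ^ l).+1)%N & msub F P = 0].
Proof.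
move=> sF; set d := (D ^ l)%N.
pose Vh t i := if unlift ord_max i is Some j then F i + t *: 'X_j ^+ D else F i.
have sV t i : (msize (Vh t i) <= D.+1)%N.
  rewrite /Vh; case: unliftP => [j _|_] //; apply: msizeD_leS => //.
  apply: leq_trans (msizeZ_le _ _) _; rewrite -[X in (_ <= X.+1)%N]mul1n.
  by apply: msizeX_leS; apply: msize_X.
pose E := 'X_{1..l.+1 < d.+1}; pose E2 := 'X_{1..l < (D * d).+1}.
(* Relations of degree at most [d] between the members of [Vh t] are the left kernel vectors of this
   coefficient matrix. *)
pose A t : 'M[C]_(#|{: E}|, #|{: E2}|) :=
  \matrix_(i, j) (mmap1 (Vh t) (enum_val i : E))@_(enum_val j : E2).
have Arel t (r : 'rV[C]_#|{: E}|) :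
    (r *m A t == 0) = (\sum_(e : E) r 0 (enum_rank e) *: mmap1 (Vh t) e == 0).
  set S := \sum_e _.
  have SE (e : E2) : S@_e = (r *m A t) 0 (enum_rank e).
    rewrite /S raddf_sum mxE (reindex (@enum_val {: E} xpredT)) /=; last by apply/onW_bij/enum_val_bij.
    by apply: eq_bigr => j _; rewrite mcoeffZ enum_valK !mxE enum_rankK.
  apply/eqP/eqP => [r0|S0].
    apply/mpolyP => m; rewrite mcoeff0; have [ma|ma] := ltnP (mdeg m) (D * d).+1.
      by have := SE (BMultinom ma); rewrite r0 mxE.
    rewrite raddf_sum big1 // => e _ /=; rewrite mcoeffZ memN_msupp_eq0 ?mulr0 //.
    apply: msize_mdeg_ge; apply: leq_trans (msize_mmap1 _ (sV t)) _.
    by apply: leq_trans ma; rewrite ltnS leq_mul2l -ltnS bmdeg.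
  by apply/rowP => j; rewrite -[j]enum_valK -SE S0 mcoeff0 mxE.
have relP t : (exists2 r : 'rV[C]_#|{: E}|, r != 0 & r *m A t = 0) ->
    exists P : {mpoly C[l.+1]}, [/\ P != 0, (msize P <= d.+1)%N & msub (Vh t) P = 0].
  move=> [r r0 /eqP]; rewrite Arel => /eqP rE.
  pose P := \sum_(e : E) r 0 (enum_rank e) *: 'X_[C, e].
  have PE (e : E) : P@_e = r 0 (enum_rank e).
    rewrite raddf_sum (bigD1 e) //= mcoeffZ mcoeffX eqxx mulr1 big1 ?addr0 // => e' ne.
    by rewrite mcoeffZ mcoeffX -bmeqP (negPf ne) mulr0.
  have sP : (msize P <= d.+1)%N.
    apply/msize_leP => mu /msupp_sum_le /flattenP[_ /mapP[e _ ->]].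
    by move/msuppZ_le/mem_msuppXP <-; rewrite -ltnS bmdeg.
  exists P; split=> //.
    apply: contra r0 => /eqP P0; apply/eqP/rowP => j.
    by rewrite -[j]enum_valK -PE P0 mcoeff0 mxE.
  by rewrite (msubE _ sP); apply: etrans rE; apply: eq_bigr => e _; rewrite PE.
have V0 : Vh 0 =1 F by move=> i; rewrite /Vh; case: unliftP => // j _; rewrite scale0r addr0.
suff [P [P0 sP PV]] : exists P : {mpoly C[l.+1]}, [/\ P != 0, (msize P <= d.+1)%N & msub (Vh 0) P = 0].
  exists P; split=> //; apply: etrans PV; apply: eq_bigr => m _; congr (_ * _).
  by apply: eq_bigr => i _; rewrite V0.
apply: relP; have [/row_freeP[B AB]|] := boolP (row_free (A 0)); last first.
  by rewrite -kermx_eq0 => /rowV0Pn[r /sub_kermxP rA r0]; exists r.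
exfalso.
have [q qE] : polyfun (fun t => \det (A t *m B)).
  apply: polyfun_det => i j.
  have [p pE] : polyfun (fun t => \sum_k A t i k * B k j).
    apply: polyfun_sum => k; apply: polyfunM; last exact: polyfun_cst.
    have H : mpolyfun (fun t => mmap1 (Vh t) (enum_val i : E)).
      apply: mpolyfun_prod => i'; apply: mpolyfunX; rewrite /Vh.
      case: unliftP => [j' _|_]; last exact: mpolyfun_cst.
      by apply: mpolyfunD; [apply: mpolyfun_cst | apply: mpolyfunZ].
    by have [p pE] := H (enum_val k : E2); exists p => t; rewrite mxE pE.
  by exists p => t; rewrite mxE pE.
have q0 : q != 0.
  by apply/eqP => q0; have /eqP := qE 0; rewrite q0 horner0 AB det1 oner_eq0.
have sF' i : (msize (F (lift ord_max i)) <= D.+1)%N by [].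
have [g g0 gP] := perturbed_relation sF'.
have [t [t0 qt gt]] := generic_reciprocal q0 g0.
have [P [P0 sP]] := gP _ gt _ (sF ord_max).
rewrite (msubE _ sP) => PE.
(* [k e] counts the perturbed factors; dividing by [t] to this power passes from X^D + t^-1 F to F +
   t X^D. *)
pose k (e : 'X_{1..l.+1}) := (\sum_i (if unlift ord_max i is Some _ then e i else 0))%N.
pose r : 'rV[C]_#|{: E}| := \row_i (P@_(enum_val i : E) * t^-1 ^+ k (enum_val i : E)).
have rA : r *m A t = 0.
  apply/eqP; rewrite Arel; apply/eqP; apply: etrans PE; apply: eq_bigr => e _.
  rewrite mxE enum_rankK -scalerA; congr (_ *: _).
  rewrite /mmap1 -mul_mpolyC rmorphXn /= /k (big_morph _ (exprD _) (expr0 _)) -big_split; apply: eq_bigr => i _ /=.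
  rewrite /Vh; case: unliftP => [j ->|->]; last by rewrite expr0 mul1r.
  rewrite -exprMn mul_mpolyC scalerDr scalerA mulVf // scale1r addrC /perturb.
  by [].
have : r *m (A t *m B) == 0 by rewrite mulmxA rA mul0mx.
have U : A t *m B \in unitmx by rewrite unitmxE unitfE qE.
move/eqP/(congr1 (mulmx^~ (invmx (A t *m B)))); rewrite mulmxK // mul0mx => r0.
case/eqP: P0; apply/mpolyP => m; rewrite mcoeff0.
have [md|md] := ltnP (mdeg m) d.+1; last by rewrite memN_msupp_eq0 // msize_mdeg_ge // (leq_trans sP).
have /rowP/(_ (enum_rank (BMultinom md))) := r0.
rewrite !mxE enum_rankK /= => /eqP; rewrite mulf_eq0 expf_eq0 invr_eq0 (negPf t0) andbF orbF.
by move/eqP.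
Qed.

Lemma size_msupp_le k d (P : {mpoly C[k]}) : (msize P <= d.+1)%N ->
  (size (msupp P) <= 'C(k + d, k))%N.
Proof.
move=> /msize_leP sP; rewrite -card_partial_ord_partitions.
pose f (m : 'X_{1..k}) : k.-tuple 'I_d.+1 := [tuple inord (m i) | i < k].
have fE m i : m \in msupp P -> nat_of_ord (tnth (f m) i) = m i.
  move=> /sP md; rewrite tnth_mktuple inordK // ltnS.
  by apply: leq_trans md; rewrite mdegE (bigD1 i) //= leq_addr.
rewrite -(size_map f) cardE; apply: uniq_leq_size.
  rewrite map_inj_in_uniq ?msupp_uniq // => m m' mP mP' ff.
  by apply/mnmP => i; rewrite -!fE // ff.
move=> _ /mapP[m mP ->]; rewrite mem_enum inE big_tuple.
by under eq_bigr do rewrite fE //; rewrite -mdegE sP.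
Qed.

End Perron3.

(** * Restriction to a line *)

Lemma digits_inj N k (a b : nat -> nat) : (forall i, a i < N)%N -> (forall i, b i < N)%N ->
  (\sum_(i < k) a i * N ^ i = \sum_(i < k) b i * N ^ i)%N -> forall i, (i < k)%N -> a i = b i.
Proof.
elim: k a b => [|k IH] a b aN bN //.
have N0 : (0 < N)%N by apply: leq_ltn_trans (aN 0%N).
have S (f : nat -> nat) : (\sum_(i < k.+1) f i * N ^ i = (\sum_(i < k) f i.+1 * N ^ i) * N + f 0)%N.
  rewrite big_ord_recl /= expn0 muln1 addnC big_distrl; congr (_ + _)%N.
  by apply: eq_bigr => i _ /=; rewrite /bump add1n expnSr mulnA.
rewrite !S => E [_|i ik].
  by have := congr1 (modn^~ N) E; rewrite !modnMDl !modn_small.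
apply: (IH (fun i => a i.+1) (fun i => b i.+1)) => //.
by have := congr1 (divn^~ N) E; rewrite !divnMDl // !divn_small // !addn0.
Qed.

Section Line.
Variables (C : numFieldType) (l : nat).
Implicit Types p q : {mpoly C[l]}.

Lemma poly_nonroot (p : {poly C}) : p != 0 -> exists z, p.[z] != 0.
Proof.
move=> p0; have [t [_ pt _]] := generic_reciprocal p0 (oner_neq0 _).
by exists t.
Qed.

Lemma meval_mmap_horner (h : 'I_l -> {poly C}) p z :
  (mmap (@polyC C) h p).[z] = p.@[fun j => (h j).[z]].
Proof.
rewrite mevalE /mmap horner_sum; apply: eq_bigr => m _.
rewrite hornerCM; congr (_ * _); rewrite /mmap1 horner_prod.
by apply: eq_bigr => i _; rewrite horner_exp.
Qed.

(* Kronecker substitution [X_i := z ^ (N ^ i)]. *)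
Lemma mpoly_nonzero_eval p : p != 0 -> exists x, p.@[x] != 0.
Proof.
move=> p0; pose N := msize p.
pose phi (m : 'X_{1..l}) := (\sum_(i < l) m i * N ^ i)%N.
pose P := mmap (@polyC C) (fun i => 'X^(N ^ i)) p.
have PE : P = \sum_(m <- msupp p) p@_m *: 'X^(phi m).
  apply: eq_bigr => m _; rewrite mul_polyC /mmap1 /phi; congr (_ *: _).
  by rewrite (big_morph _ (exprD _) (expr0 _)); apply: eq_bigr => i _; rewrite mulnC exprM.
have mN m i : m \in msupp p -> (m i < N)%N.
  by move=> /msize_mdeg_lt; apply: leq_ltn_trans; rewrite mdegE (bigD1 i) //= leq_addr.
have phi_inj m m' : m \in msupp p -> m' \in msupp p -> phi m = phi m' -> m = m'.
  move=> mp mp' E; apply/mnmP => i.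
  pose f (m : 'X_{1..l}) k := if insub k is Some j then m (j : 'I_l) else 0%N.
  have fE (m0 : 'X_{1..l}) (j : 'I_l) : f m0 j = m0 j by rewrite /f valK.
  have fN (m0 : 'X_{1..l}) k : m0 \in msupp p -> (f m0 k < N)%N.
    move=> m0p; rewrite /f; case: insubP => [j _ _|_]; first exact: mN.
    by rewrite lt0n msize_poly_eq0.
  rewrite -!fE; apply: (@digits_inj N l (f m) (f m')) => //; try by move=> k; apply: fN.
  by under eq_bigr do rewrite fE; under [RHS]eq_bigr do rewrite fE.
have P0 : P != 0.
  have mp := mlead_supp p0.
  apply/eqP => /(congr1 (fun q : {poly C} => q`_(phi (mlead p)))).
  rewrite PE coef_sum coef0 (bigD1_seq _ mp) ?msupp_uniq //= coefZ coefXn eqxx mulr1.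
  rewrite big_seq_cond big1 ?addr0; first by apply/eqP; rewrite mleadc_eq0.
  move=> m /andP[mp' ne]; rewrite coefZ coefXn; case: eqP => [/phi_inj E|_]; last by rewrite mulr0.
  by rewrite E ?eqxx in ne.
have [z Pz] := poly_nonroot P0; exists (fun i => ('X^(N ^ i)).[z]).
by rewrite -meval_mmap_horner.
Qed.

Definition line (u v : 'I_l -> C) (j : 'I_l) : {poly C} := (u j)%:P + (v j - u j) *: 'X.

Lemma line0 u v p : (mmap (@polyC C) (line u v) p).[0] = p.@[u].
Proof.
rewrite meval_mmap_horner; apply: meval_eq => j.
by rewrite /line !hornerE.
Qed.

Lemma line1 u v p : (mmap (@polyC C) (line u v) p).[1] = p.@[v].
Proof.
rewrite meval_mmap_horner; apply: meval_eq => j.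
by rewrite /line hornerD hornerC hornerZ hornerX mulr1 addrC subrK.
Qed.

Lemma size_mul_leS (p q : {poly C}) a b :
  (size p <= a.+1 -> size q <= b.+1 -> size (p * q)%R <= (a + b).+1)%N.
Proof.
move=> pa qb; apply: leq_trans (size_polyMleq p q) _.
by rewrite -subn1 leq_subLR add1n -addnS -addSn leq_add.
Qed.

Lemma size_prod_leS (I : Type) (r : seq I) P (F : I -> {poly C}) (a : I -> nat) :
  (forall i, size (F i) <= (a i).+1)%N ->
  (size (\prod_(i <- r | P i) F i)%R <= (\sum_(i <- r | P i) a i).+1)%N.
Proof.
move=> H; elim: r => [|i r IH]; first by rewrite !big_nil size_poly1.
by rewrite !big_cons; case: (P i) => //; apply: size_mul_leS.
Qed.

Lemma size_exp_leS (p : {poly C}) a k :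
  (size p <= a.+1 -> size (p ^+ k) <= (a * k).+1)%N.
Proof.
move=> pa; elim: k => [|k IH]; first by rewrite expr0 muln0 size_poly1.
by rewrite exprS mulnS; apply: size_mul_leS.
Qed.

Lemma size_line u v p d : (msize p <= d.+1)%N -> (size (mmap (@polyC C) (line u v) p) <= d.+1)%N.
Proof.
move=> /msize_leP pd; rewrite /mmap big_seq; apply: (leq_trans (size_sum _ _ _)).
apply/bigmax_leqP_seq => m _ /pd md; rewrite mul_polyC.
apply: leq_trans (size_scale_leq _ _) _; apply: (@leq_trans (mdeg m).+1) => //.
rewrite mdegE; apply: size_prod_leS => i.
rewrite -[X in (_ <= X.+1)%N]mul1n; apply: size_exp_leS.
rewrite /line; apply: leq_trans (size_polyD _ _) _.
rewrite geq_max size_polyC; case: (_ == 0) => /=; last first.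
  by apply: leq_trans (size_scale_leq _ _) _; rewrite size_polyX.
by apply: leq_trans (size_scale_leq _ _) _; rewrite size_polyX.
Qed.

(* For two points [u], [v] in general position, the monomials in [F] have
   nonconstant ratios already on the line through [u] and [v]. *)
Lemma mpowers_independent k D t m (F : 'I_k -> {mpoly C[l]}) (al : 'I_t -> 'X_{1..k}) :
    (0 < k * D)%N ->
    (forall i, msize (F i) <= D.+1)%N -> (forall i, F i != 0) ->
    (forall i j c, i != j -> mmap1 F (al j) <> c *: mmap1 F (al i)) ->
    ('C(t.-1, 2) * (k * D - 1) < m)%N ->
  forall c : 'I_t -> C, \sum_i c i *: mmap1 F (al i) ^+ m = 0 -> forall i, c i = 0.
Proof.
move=> kD1 sF F0 prop bnd c rel.
pose Y i := mmap1 F (al i).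
have Y0 i : Y i != 0 by apply/prodf_neq0 => j _; apply: expf_neq0.
have [v vP] : exists v, (\prod_i F i).@[v] != 0.
  by apply: mpoly_nonzero_eval; apply/prodf_neq0 => i _.
have Fv i : (F i).@[v] != 0.
  by apply: contra vP => /eqP Fi; rewrite rmorph_prod (bigD1 i) //= Fi mul0r.
have Yv i : (Y i).@[v] != 0.
  by rewrite /Y /mmap1 rmorph_prod /=; apply/prodf_neq0 => j _; rewrite rmorphXn /= expf_neq0.
(* A point [u] where no [W i j] vanishes prevents proportionality on the line, since the values at
   [u] and [v] would contradict it. *)
pose W i j := (Y i).@[v] *: Y j - (Y j).@[v] *: Y i.
have [u uP] : exists u, (\prod_i \prod_(j | i != j) W i j).@[u] != 0.
  apply: mpoly_nonzero_eval; apply/prodf_neq0 => i _; apply/prodf_neq0 => j ij.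
  rewrite subr_eq0; apply/eqP => E.
  apply: (prop i j ((Y j).@[v] / (Y i).@[v]) ij).
  by rewrite mulrC -scalerA -[X in _ *: X]E scalerA mulVf // scale1r.
have Wu i j : i != j -> (W i j).@[u] != 0.
  move=> ij; apply: contra uP => /eqP Wi.
  by rewrite rmorph_prod (bigD1 i) //= rmorph_prod (bigD1 j) //= Wi !mul0r.
pose phi := mmap (@polyC C) (line u v).
pose f i := phi (F i).
pose R := \prod_i f i.
have f0 i : f i != 0.
  by apply: contra (Fv i) => /eqP fi; rewrite -(line1 u v) -/(phi _) -/(f _) fi horner0.
have phiY i : phi (Y i) = \prod_j f j ^+ al i j.
  by rewrite /phi rmorph_prod /=; apply: eq_bigr => j _; rewrite rmorphXn.
(* This is [R] times the logarithmic derivative of [phi (Y i)]; its degree is at most [k * D - 1]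
   whatever the exponents. *)
pose L i := \sum_j (f j)^`() * (\prod_(k' | k' != j) f k') *+ al i j.
have sf i : (size (f i) <= D.+1)%N by apply: size_line.
apply: (@powers_independent C t (k * D - 1) m R (fun i => phi (Y i)) L _ _ _ _ _ _ bnd).
- by apply/prodf_neq0 => i _.
- apply: (leq_trans (size_prod_leS _ _ sf)).
  by rewrite sum_nat_const card_ord; lia.
- by move=> i; rewrite phiY; apply/prodf_neq0 => j _; apply: expf_neq0.
- move=> i; rewrite phiY /L.
  have step j e : R * (f j ^+ e)^`() = f j ^+ e * ((f j)^`() * (\prod_(k' | k' != j) f k') *+ e).
    rewrite deriv_exp /R (bigD1 j) //=; case: e => [|e]; first by rewrite !mulr0n !mulr0.
    rewrite /= !mulrnAr exprS; congr (_ *+ _).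
    by move: (f j)^`() (f j) (bigop.body _ _ _) (_ ^+ e) => *; clear; ring.
  elim/big_rec2: _ => [|j S T _ IH]; first by rewrite derivC mulr0 mulr0.
  by rewrite derivM mulrDr mulrA step [R * (_ * _)]mulrCA IH; move: (_ *+ _) => *; clear; ring.
- move=> i; apply: (leq_trans (size_sum _ _ _)); apply/bigmax_leqP => j _.
  rewrite -mulr_natr -polyC_natr mulrC mul_polyC; apply: leq_trans (size_scale_leq _ _) _.
  have sd : (size (f j)^`() <= D)%N.
    by rewrite -ltnS; apply: leq_trans (sf j); apply: lt_size_deriv.
  have sp : (size (\prod_(k' | k' != j) f k')%R <= (\sum_(k' < k | k' != j) D).+1)%N.
    exact: size_prod_leS.
  have E : (\sum_(k' < k | k' != j) D + D = k * D)%N.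
    have <- : (\sum_(k' < k) D = k * D)%N by rewrite sum_nat_const card_ord.
    by rewrite [RHS](bigD1 j) //= addnC.
  have arith a b S T : (0 < T -> a <= D -> b <= S.+1 -> S + D = T -> (a + b).-1 <= (T - 1).+1)%N.
    by clear; lia.
  by apply: leq_trans (size_polyMleq _ _) _; apply: arith kD1 sd sp E.
- move=> i j c' ij E.
  have E0 := congr1 (fun q : {poly C} => q.[0]) E; have E1 := congr1 (fun q : {poly C} => q.[1]) E.
  rewrite /= hornerZ !line0 in E0; rewrite /= hornerZ !line1 in E1.
  have := Wu i j ij; rewrite rmorphB /= !mevalZ E0 E1.
  by rewrite mulrCA -mulrA subrr eqxx.
have /(congr1 phi) := rel.
rewrite /phi rmorph0 rmorph_sum /= => E; apply: etrans E; apply: eq_bigr => i _.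
by rewrite mmapZ rmorphXn /= mul_polyC.
Qed.

End Line.

(** * The covering *)

Section Cover.
Variables (C : numClosedFieldType) (l D' : nat).
Local Notation D := D'.+1.
Local Notation msub h := (mmap (@mpolyC l C) h).

Lemma minimal_relation (F : 'I_l.+1 -> {mpoly C[l]}) d (P : {mpoly C[l.+1]}) :
    P != 0 -> (msize P <= d.+1)%N -> msub F P = 0 ->
  exists P' : {mpoly C[l.+1]}, [/\ P' != 0, (msize P' <= d.+1)%N, msub F P' = 0 &
    forall R : {mpoly C[l.+1]}, R != 0 -> (msize R <= d.+1)%N -> msub F R = 0 ->
      (size (msupp P') <= size (msupp R))%N].
Proof.
move: {2}(size (msupp P)) (leqnn (size (msupp P))) => n.
elim: n P => [|n IH] P sn P0 sP FP.
  by move: P0; rewrite -msupp_eq0 -size_eq0; move: sn; rewrite leqn0 => ->.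
have [[R [R0 sR FR lt]]|nR] := boolp.EM (exists R : {mpoly C[l.+1]},
   [/\ R != 0, (msize R <= d.+1)%N, msub F R = 0 & (size (msupp R) < size (msupp P))%N]).
  by apply: (IH R) => //; rewrite -ltnS; apply: leq_trans lt sn.
exists P; split=> // R R0 sR FR; rewrite leqNgt; apply/negP => lt.
by apply: nR; exists R.
Qed.

Lemma is_unity_prod (I : Type) (r : seq I) (w : I -> C) (e : I -> nat) :
  (forall i, is_unity (w i)) -> is_unity (\prod_(i <- r) w i ^+ e i).
Proof.
move=> wu; elim: r => [|i r IH]; first by rewrite big_nil; exists 1%N.
rewrite big_cons; apply: is_unityM => //; have [n n0 wn] := wu i.
by exists n; rewrite // exprAC wn expr1n.
Qed.

(** For each sign pattern on the monomials other than the first, [G s] is the product of the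
    sign-changed relation and the conjugated one, so that a single equation covers both alternatives
    of [torsion_cover]. *)
Lemma torsion_hypersurfaces (F : 'I_l.+1 -> {mpoly C[l]}) K g :
    (forall i, msize (F i) <= D.+1)%N -> (forall i, F i != 0) ->
    (forall (m m' : 'X_{1..l.+1}) c, m != m' -> mmap1 F m' <> c *: mmap1 F m) ->
    g = 'C(l.+1 + D ^ l, l.+1) -> (0 < K)%N -> ('C(g.-1, 2) * (l.+1 * D - 1) < 2 ^ K)%N ->
  exists n (G : {ffun 'I_n -> bool} -> {mpoly C[l]}),
    [/\ (n <= g.-1)%N, forall s, G s != 0,
        forall s, (msize (G s) <= ((2 ^ K + 1) * (D * D ^ l)).+1)%N
      & forall x, (forall i, is_unity (F i).@[x]) -> exists s, (G s).@[x] = 0].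
Proof.
move=> sF F0 prop gE K0 bnd; have [P1 [P10 sP1 FP1]] := perron sF.
have [P [P0 sP FP Pmin]] := minimal_relation P10 sP1 FP1.
have tg : (size (msupp P) <= g)%N by rewrite gE; apply: size_msupp_le.
set d := (D ^ l)%N in sP.
have : (0 < size (msupp P))%N by rewrite lt0n size_eq0 msupp_eq0.
case tE : (size (msupp P)) => [|n] // _.
pose al (i : 'I_n.+1) := nth 0%MM (msupp P) i.
have alP i : al i \in msupp P by rewrite mem_nth // tE.
have al_inj i j : i != j -> al i != al j.
  by move=> ij; rewrite nth_uniq ?tE ?msupp_uniq.
have sum_al (V : nmodType) (f : 'X_{1..l.+1} -> V) : \sum_(m <- msupp P) f m = \sum_i f (al i).
  by rewrite (big_nth 0%MM) tE big_mkord.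
pose p0 := P@_(al ord0).
have p0n : p0 != 0 by rewrite -mcoeff_msupp.
pose a i := P@_(al i) / p0.
have a0 : a ord0 = 1 by rewrite /a mulfV.
have an0 i : a i != 0 by rewrite mulf_neq0 ?invr_neq0 // -mcoeff_msupp.
pose Y i := mmap1 F (al i).
have aY : \sum_i a i *: Y i = 0.
  have : p0^-1 *: msub F P = 0 by rewrite FP scaler0.
  rewrite /mmap sum_al scaler_sumr => E; apply: etrans E; apply: eq_bigr => i _.
  by rewrite mul_mpolyC scalerA mulrC.
have sY i : (msize (Y i) <= (D * d).+1)%N.
  apply: leq_trans (msize_mmap1 _ sF) _; rewrite ltnS leq_mul2l; apply/orP; right.
  by apply: (msize_leP _ _ sP).
(* Subtracting [c ord0] times [a] removes the first monomial, and minimality of the support excludes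
   a shorter nonzero relation. *)
have key (c : 'I_n.+1 -> C) : (forall lam, ~ (c =1 fun i => lam * a i)) ->
    \sum_i c i *: Y i != 0.
  move=> cprop; apply/eqP => cY.
  pose R : {mpoly C[l.+1]} := \sum_i (c i - c ord0 * a i) *: 'X_[al i].
  have Rco i : R@_(al i) = c i - c ord0 * a i.
    rewrite raddf_sum (bigD1 i) //= mcoeffZ mcoeffX eqxx mulr1 big1 ?addr0 // => j ji.
    by rewrite mcoeffZ mcoeffX (negPf (al_inj _ _ ji)) mulr0.
  have Rsup m : m \in msupp R -> m \in behead (msupp P).
    move=> mR; have /flattenP[_ /mapP[i _ ->]] := msupp_sum_le mR.
    move/msuppZ_le/mem_msuppXP => E; move: mR; rewrite -{}E => aR.
    have i0 : i != ord0.
      by apply: contraL aR => /eqP->; rewrite mcoeff_msupp Rco a0 mulr1 subrr eqxx.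
    apply/(nthP 0%MM); exists i.-1; first by rewrite size_behead tE prednK ?lt0n // -ltnS ltn_ord.
    by rewrite nth_behead prednK // lt0n.
  have R0 : R != 0.
    apply/eqP => R0; apply: (cprop (c ord0)) => i; apply/eqP.
    by rewrite -subr_eq0 -Rco R0 mcoeff0.
  have sR : (msize R <= d.+1)%N.
    apply/msize_leP => m /Rsup/mem_behead mP; exact: (msize_leP _ _ sP).
  have FR : msub F R = 0.
    rewrite raddf_sum /=.
    transitivity (\sum_i c i *: Y i - c ord0 *: \sum_i a i *: Y i); last by rewrite cY aY scaler0 subrr.
    rewrite scaler_sumr -sumrB; apply: eq_bigr => i _.
    by rewrite mmapZ mmapX mul_mpolyC scalerBl scalerA.
  have := Pmin R R0 sR FR; rewrite tE leqNgt => /negP; apply.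
  have := uniq_leq_size (msupp_uniq R) Rsup; rewrite size_behead tE /=.
  by rewrite ltnS.
have [kappa [c [cP cov]]] := torsion_cover a0 K0.
have indep (b : 'I_n.+1 -> C) : b ord0 != 0 -> \sum_i b i *: Y i ^+ (2 ^ K) != 0.
  move=> b0; apply/eqP => bY; move: b0.
  rewrite (@mpowers_independent C l l.+1 D n.+1 (2 ^ K) F al _ sF F0 _ _ b bY) ?eqxx //.
    by move=> i j c' ij; apply: prop; apply: al_inj.
  apply: leq_ltn_trans bnd; rewrite leq_mul2r; apply/orP; right; apply: leq_bin2l.
  by move: tg; rewrite tE; clear; lia.
pose pat (s : {ffun 'I_n -> bool}) i := if unlift ord0 i is Some j then s j else false.
have pat0 s : pat s ord0 = false by rewrite /pat unlift_none.
(* Without any minus sign the sum would be the zero polynomial; the value 1 stands in, as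
   [torsion_cover] uses this factor only when some sign is -1. *)
pose A s := if [exists i, pat s i] then \sum_i ((-1) ^+ pat s i * a i) *: Y i else 1.
pose B s := \sum_i c (pat s) i *: Y i ^+ kappa.
have sZ (f : 'I_n.+1 -> C) e : (msize (\sum_i f i *: Y i ^+ e) <= (D * d * e).+1)%N.
  apply: leq_trans (msize_sum _ _ _) _; apply/bigmax_leqP => i _.
  by apply: leq_trans (msizeZ_le _ _) _; apply: msizeX_leS.
have kK : (kappa <= 2 ^ K)%N by case: cP => -[-> _] //; rewrite expn_gt0.
exists n, (fun s => A s * B s); split.
- by move: tg; rewrite tE; clear; lia.
- move=> s; apply: mulf_neq0.
    rewrite /A; case: existsP => [[i si]|_]; last exact: oner_neq0.
    apply: key => lam E; have := E ord0; rewrite pat0 mul1r a0 mulr1 => lam1.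
    have /eqP := E i; rewrite si -lam1 expr1 mul1r mulN1r eq_sym -addr_eq0 -mulr2n.
    by rewrite -mulr_natr mulf_eq0 (negPf (an0 i)) pnatr_eq0.
  rewrite /B; case: cP => -[-> cP]; last by apply: indep; apply: cP.
  by under eq_bigr do rewrite expr1; apply: key => lam; apply: cP.
- move=> s; rewrite mulnDl mul1n addnC; apply: msizeM_leS.
    rewrite /A; case: ifP => _; last by rewrite msize1.
    have := sZ (fun i => (-1) ^+ pat s i * a i) 1%N; rewrite muln1.
    by under eq_bigr do rewrite expr1.
  apply: leq_trans (sZ _ _) _; rewrite ltnS mulnC leq_mul2r; apply/orP; right.
  exact: kK.
move=> x xu.
pose w i := (Y i).@[x].
have wE i : w i = \prod_j (F j).@[x] ^+ al i j.
  by rewrite /w /Y /mmap1 rmorph_prod /=; apply: eq_bigr => j _; rewrite rmorphXn.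
have wu i : is_unity (w i) by rewrite wE; apply: is_unity_prod.
have aw : \sum_i a i * w i = 0.
  have := congr1 (fun p : {mpoly C[l]} => p.@[x]) aY.
  rewrite /= meval0 raddf_sum /= => E; apply: etrans E; apply: eq_bigr => i _.
  by rewrite mevalZ.
have [s s0 sP'] := cov w wu aw.
pose sf : {ffun 'I_n -> bool} := [ffun j => s (lift ord0 j)].
have sE : pat sf = s.
  apply: boolp.funext => i; rewrite /pat; case: unliftP => [j ->|->]; first by rewrite ffunE.
  by rewrite s0.
exists sf; rewrite mevalM /A /B sE; apply/eqP; rewrite mulf_eq0; apply/orP.
case: sP' => [[[i si] E]|E]; [left | right].
  have -> : [exists i, s i] by apply/existsP; exists i.
  rewrite raddf_sum; apply/eqP; apply: etrans E; apply: eq_bigr => j _.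
  by rewrite /= mevalZ.
rewrite raddf_sum; apply/eqP; apply: etrans E; apply: eq_bigr => j _.
by rewrite /= mevalZ rmorphXn.
Qed.

(** Evaluation at the torsion point [x] shows that [c] is a root of unity; a power of the
    proportionality is then a multiplicative relation. *)
Lemma mult_independent_ratio (F : 'I_l.+1 -> {mpoly C[l]}) (x : 'I_l -> C)
    (m m' : 'X_{1..l.+1}) c :
  mult_independent F -> (forall i, is_unity (F i).@[x]) -> m != m' ->
  mmap1 F m' <> c *: mmap1 F m.
Proof.
move=> Find xu mm' E.
have F0 i : F i != 0.
  by apply: contraNneq (is_unity_neq0 (xu i)) => ->; rewrite meval0.
have ev (e : 'X_{1..l.+1}) : is_unity (mmap1 F e).@[x].
  rewrite /mmap1 rmorph_prod /=; under eq_bigr do rewrite rmorphXn /=.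
  exact: is_unity_prod.
have cE : (mmap1 F m').@[x] = c * (mmap1 F m).@[x] by rewrite E mevalZ.
have [N N0 cN] : is_unity c.
  have -> : c = (mmap1 F m').@[x] * ((mmap1 F m).@[x])^-1.
    by rewrite cE mulfK // is_unity_neq0.
  exact/is_unityM/is_unityV.
have EN : mmap1 F m' ^+ N = mmap1 F m ^+ N by rewrite E exprZn cN scale1r.
apply: Find; exists (fun i => (N * m' i)%N%:Z - (N * m i)%N%:Z); split.
  have [i mi] : exists i, m i != m' i.
    apply/existsP/contraT; rewrite negb_exists => /forallP H.
    by case/eqP: mm'; apply/mnmP => i; apply/eqP; move: (H i); rewrite negbK.
  exists i; rewrite subr_eq0 eqz_nat eqn_pmul2l // eq_sym.
  exact: mi.
have tF i : tofrac (F i) != 0 :> {fraction {mpoly C[l]}} by rewrite tofrac_eq0.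
have tE (e : 'X_{1..l.+1}) : \prod_i (tofrac (F i) : {fraction {mpoly C[l]}}) ^+ (N * e i)
    = tofrac (mmap1 F e ^+ N).
  rewrite rmorphXn /mmap1 rmorph_prod /= -prodrXl; apply: eq_bigr => i _.
  by rewrite rmorphXn /= -exprM mulnC.
under eq_bigr do rewrite expfzDr // -invr_expz -!exprnP.
rewrite prodf_div /= !tE EN mulfV // tofrac_eq0 expf_neq0 //.
by apply/prodf_neq0 => i _; apply: expf_neq0.
Qed.
End Cover.

Local Open Scope classical_set_scope.

Theorem theorem1p5 (R : realType) (l D : nat)
    (l_ge1 : (1 <= l)%N) (D_ge1 : (1 <= D)%N)
    (F : 'I_(l + 1) -> {mpoly R[i][l]})
    (F_indep : mult_independent F)
    (F_deg : forall i, (tdegree (F i) <= D)%N) :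
  exists (N : nat) (V : 'I_N -> set ('I_l -> R[i])),
    [/\ (N%:R : R) <=
          ((792%:R / 1000%:R) * (gamma l D)%:R / exp.ln ((gamma l D)%:R + 1))
            ^+ gamma l D,
        forall j, variety_defined_by_at_most (l + 1)
          ((l + 1) * D ^ (l + 1) * primorial (gamma l D))%N (V j)
      & \bigcup_(n in [set n : 'I_(l + 1) -> nat | forall i, (1 <= n i)%N])
          zero_set (fun i => F i ^+ n i - 1)
        `<=` \bigcup_j V j].
Proof.
have g3 := gamma_ge3 l_ge1 D_ge1.
have Nbnd := two_pow_le R g3.
have [K [K0 Kb KQ]] := exponent_choice l_ge1 D_ge1.
set g := gamma l D in g3 Nbnd Kb KQ *.
have gE : g = 'C((l + 1) + D ^ l, l + 1) by [].
set Qg := primorial g in KQ *; clearbody Qg g.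
case: D D_ge1 F_deg gE Kb => // D' _ F_deg gE Kb.
move: F F_indep F_deg gE Kb KQ; rewrite addn1 => F F_indep F_deg gE Kb KQ.
have sF i : (msize (F i) <= D'.+2)%N.
  by have := F_deg i; rewrite /tdegree; case: (msize _).
pose Z := \bigcup_(n in [set n : 'I_l.+1 -> nat | forall i, (1 <= n i)%N])
  zero_set (fun i => F i ^+ n i - 1).
have ZP x : Z x -> forall i, is_unity (F i).@[x].
  move=> [n /= n1 xn] i; exists (n i) => //; have := xn i.
  by rewrite mevalB meval1 rmorphXn /= => /eqP; rewrite subr_eq0 => /eqP.
(* An empty union is covered by no variety at all. Otherwise one torsion point shows that the [F i]
   are nonzero and that their monomials are pairwise nonproportional. *)
have [[x0 Zx0]|Z0] := boolp.EM (exists x, Z x); last first.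
  exists 0%N, (fun=> set0); split; first by apply: le_trans Nbnd; rewrite ler_nat.
    by case.
  by move=> x Zx; case: Z0; exists x.
have F0 i : F i != 0.
  by apply: contraNneq (is_unity_neq0 (ZP x0 Zx0 i)) => ->; rewrite meval0.
have prop (m m' : 'X_{1..l.+1}) c := @mult_independent_ratio _ l F x0 m m' c F_indep (ZP x0 Zx0).
have [n [G [ng G0 sG GP]]] := torsion_hypersurfaces sF F0 prop gE K0 Kb.
exists #|{: {ffun 'I_n -> bool}}|, (fun j => zero_set (fun _ : 'I_1 => G (enum_val j))).
split.
- apply: le_trans Nbnd; rewrite ler_nat card_ffun card_bool card_ord.
  by rewrite leq_exp2l.
- move=> j; exists 1%N, (fun=> G (enum_val j)); split=> // _.
  (* The factor [2 ^ K + 1] was chosen to be at most [l + 1] times the primorial. *)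
  apply: (@leq_trans ((2 ^ K + 1) * D'.+1 ^ l.+1)).
    by rewrite /tdegree expnS; move: (sG (enum_val j)); case: (msize _).
  by rewrite mulnAC leq_mul2r KQ orbT.
move=> x Zx; have [s Gs] := GP x (ZP x Zx).
by exists (enum_rank s) => // _; rewrite enum_rankK.
Qed.
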